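(* Let $\Omega\subset\mathbb{R}^N$ be a Friedrichs admissible domain with best Friedrichs constant $c_{\mathsf f}$. Define the Dirichlet bi-Laplacian $B_{\mathtt D}:=L\mathring{L}$, i.e. $B_{\mathtt D}u=\Delta^2u$ with $$D(B_{\mathtt D})=\{u\in\mathring{\mathsf H}^2(\Omega):\Delta^2u\in\mathsf L^2(\Omega)\}.$$ Then $B_{\mathtt D}:D(B_{\mathtt D})\subset\mathsf L^2(\Omega)\to\mathsf L^2(\Omega)$ is selfadjoint, positive and bijective (in particular $R(B_{\mathtt D})=\mathsf L^2(\Omega)$), with bounded inverse satisfying $\|B_{\mathtt D}^{-1}\|_{\mathsf L^2(\Omega)\to\mathsf L^2(\Omega)}\le c_{\mathsf f}^4$, and for all $\varphi\in D(B_{\mathtt D})$ $$\|\varphi\|_{\mathsf L^2(\Omega)}\le c_{\mathsf f}^2\|\Delta\varphi\|_{\mathsf L^2(\Omega)}\le c_{\mathsf f}^4\|\Delta^2\varphi\|_{\mathsf L^2(\Omega)}.$$ For every $f\in\mathsf L^2(\Omega)$, $u=B_{\mathtt D}^{-1}f$ is the unique $u\in\mathring{\mathsf H}^2(\Omega)$ with $\Delta^2u=f$ in $\Omega$, and it is the unique $u\in\mathring{\mathsf H}^2(\Omega)$ satisfying $$\langle\Delta u,\Delta\varphi\rangle_{\mathsf L^2(\Omega)}=\langle f,\varphi\rangle_{\mathsf L^2(\Omega)}\qquad\text{for all }\varphi\in\mathring{\mathsf H}^2(\Omega).$$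
   Context: A domain is a (nonempty) connected open set $\Omega\subset\mathbb{R}^N$, $N\in\mathbb{N}$; no regularity of the boundary is assumed. $\mathring{\mathsf H}^k(\Omega)$ is the closure of the compactly supported smooth functions $\mathring{\mathsf C}^\infty(\Omega)$ in $\mathsf H^k(\Omega)$. $\Omega$ is called Friedrichs admissible if there is $c_{\mathsf f}>0$ with $\|\varphi\|_{\mathsf L^2(\Omega)}\le c_{\mathsf f}\|\nabla\varphi\|_{\mathsf L^2(\Omega)}$ for all $\varphi\in\mathring{\mathsf H}^1(\Omega)$; $c_{\mathsf f}$ denotes the best such constant. All differential operators are distributional. $\mathsf H(\Delta,\Omega):=\{\varphi\in\mathsf L^2(\Omega):\Delta\varphi\in\mathsf L^2(\Omega)\}$. $\mathring{L}:\mathring{\mathsf H}^2(\Omega)\subset\mathsf L^2(\Omega)\to\mathsf L^2(\Omega)$, $\varphi\mapsto-\Delta\varphi$, and $L:\mathsf H(\Delta,\Omega)\subset\mathsf L^2(\Omega)\to\mathsf L^2(\Omega)$, $\varphi\mapsto-\Delta\varphi$. Positive means $\langle Bu,u\rangle>0$ for all $0\ne u$ in the domain. *)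

(* Defs.v *)
(* R^N is 'rV[R]_N, and scalars are real: L^2(Omega) consists of real-valued
   functions. *)
From HB Require Import structures.
From mathcomp Require Import all_boot all_order all_algebra.
From mathcomp Require Import all_classical all_reals all_analysis measurable_realfun.
Set Implicit Arguments.
Unset Strict Implicit.
Unset Printing Implicit Defensive.
Import Order.TTheory GRing.Theory Num.Theory.
Import numFieldNormedType.Exports.
Local Open Scope classical_set_scope.
Local Open Scope ring_scope.

Definition borel_rV_display : measure_display.
Proof. exact: default_measure_display. Qed.

Section borel_rV.
Context {R : realType} (n : nat).

Definition borel_rV : set (set 'rV[R]_n) := <<s open >>.

Let borel_rV0 : borel_rV set0.
Proof. exact: sigma_algebra0. Qed.

Let borel_rVC A : borel_rV A -> borel_rV (~` A).
Proof. exact: sigma_algebraC. Qed.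

Let borel_rV_bigcup (F : (set 'rV[R]_n)^nat) :
  (forall i, borel_rV (F i)) -> borel_rV (\bigcup_i F i).
Proof. exact: sigma_algebra_bigcup. Qed.

HB.instance Definition _ := @isMeasurable.Build borel_rV_display
  'rV[R]_n borel_rV borel_rV0 borel_rVC borel_rV_bigcup.

End borel_rV.

Section borel_rV_theory.
Context {R : realType} (n : nat).

Lemma open_measurable_rV (A : set 'rV[R]_n) : open A -> measurable A.
Proof. by move=> oA; exact: sub_sigma_algebra. Qed.

Definition rat_box (c : 'rV[rat]_n * rat) : set 'rV[R]_n :=
  [set x | forall i, `|x ord0 i - ratr (c.1 ord0 i)| < ratr c.2].

Lemma open_bigcup_rat_box (A : set 'rV[R]_n) : open A ->
  A = \bigcup_(c in [set c | rat_box c `<=` A]) rat_box c.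
Proof.
move=> oA; apply/seteqP; split=> [x Ax|x [c /= cA]]; last exact: cA.
have /nbhs_ballP[e/= e0 xeA] : nbhs x A by exact: open_nbhs_nbhs.
have e2 : 0 < e / 2 by rewrite divr_gt0.
have [r] := rat_in_itvoo e2; rewrite in_itv/= => /andP[r0 re].
have /choice[q qP] : forall i : 'I_n, exists q : rat,
    `|x ord0 i - ratr q| < ratr r.
  move=> i; have : x ord0 i - ratr r < x ord0 i + ratr r.
    by rewrite ltrD2l gt0_cp.
  by move=> /rat_in_itvoo[q]; rewrite in_itv/= -ltr_distlC; exists q.
exists (\row_i q i, r) => /=; last by move=> i; rewrite mxE.
move=> y yq; apply: xeA; split => // i j; rewrite [i]ord1.
have := yq j; have := qP j; rewrite /ball/= !mxE => xq yq'.
rewrite -(subrK (ratr (q j)) (x _ _)) -addrA (splitr e).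
rewrite (le_lt_trans (ler_normD _ _))// ltrD// (lt_trans _ re)//.
by rewrite distrC.
Qed.

Lemma measurable_fun_rV d (T : measurableType d) (f : T -> 'rV[R]_n) :
  (forall i, measurable_fun [set: T] (fun t => f t ord0 i)) ->
  measurable_fun [set: T] f.
Proof.
move=> mf; apply: (@measurability _ _ T _ setT f (@open _ : set (set 'rV[R]_n))) => //.
move=> _ [A oA <-]; rewrite setTI (open_bigcup_rat_box oA) preimage_bigcup.
rewrite bigcup_mkcond.
apply: countable_bigcupT_measurable; first exact: countableP.
move=> c; case: ifPn => // _.
rewrite (_ : _ @^-1` _ = \bigcap_(i in [set: 'I_n])
   (fun t => f t ord0 i) @^-1` ball (ratr (c.1 ord0 i) : R) (ratr c.2)); last first.
  apply/seteqP; split=> [t ft i _|t ft i].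
    by rewrite /= /ball/= distrC; exact: ft.
  by have := ft i I; rewrite /= /ball/= distrC.
apply: fin_bigcap_measurable => // i _; rewrite -[X in measurable X]setTI.
by apply: mf => //; exact: open_measurable (ball_open _ _).
Qed.

End borel_rV_theory.

Lemma measurable_rV_coord {R : realType} (n : nat) (i : 'I_n) :
  measurable_fun [set: 'rV[R]_n] (fun x => x ord0 i).
Proof.
apply: (measurability _ (RGenOpens.measurableE R)).
move=> _ [_ [a [b ->] <-]]; rewrite setTI; apply: open_measurable_rV.
apply: open_comp; last exact: interval_open.
by move=> x _; exact: coord_continuous.
Qed.

Section lebesgue_rV_step.
Context {R : realType} (n : nat).

Definition rV_cons (p : measurableTypeR R * 'rV[R]_n) : 'rV[R]_n.+1 :=
  row_mx (p.1 : R)%:M p.2.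

Lemma measurable_rV_cons : measurable_fun [set: _ * _] rV_cons.
Proof.
apply: measurable_fun_rV => i; case: (@split_ordP 1 n i) => j ->.
  rewrite (_ : (fun _ => _) = fst) //.
  by apply/funext => t; rewrite [LHS](@row_mxEl R 1 1 n) [j]ord1 mxE eqxx.
rewrite (_ : (fun _ => _) = (fun x : 'rV[R]_n => x ord0 j) \o snd).
  by apply: measurableT_comp => //; exact: measurable_rV_coord.
by apply/funext => t; exact: (@row_mxEr R 1 1 n).
Qed.

Variable mu : {sigma_finite_measure set 'rV[R]_n -> \bar R}.

Definition lebesgue_cons : set 'rV[R]_n.+1 -> \bar R :=
  pushforward (lebesgue_measure \x mu)%E rV_cons.

Let lebesgue_cons0 : lebesgue_cons set0 = 0%E.
Proof. by rewrite /lebesgue_cons /pushforward preimage_set0 measure0. Qed.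

Let lebesgue_cons_ge0 A : (0 <= lebesgue_cons A)%E.
Proof. exact: (measure_ge0 (lebesgue_measure \x mu)%E). Qed.

Let lebesgue_cons_sigma_additive : semi_sigma_additive lebesgue_cons.
Proof.
have mV A : measurable A -> measurable (rV_cons @^-1` A).
  by move=> mA; rewrite -[X in measurable X]setTI; exact: measurable_rV_cons.
move=> F mF tF mUF; rewrite /lebesgue_cons /pushforward preimage_bigcup.
apply: measure_semi_sigma_additive => [k||]; first exact: mV.
- apply/trivIsetP => /= i j _ _ ij; rewrite -preimage_setI.
  by move/trivIsetP : tF => /(_ _ _ _ _ ij) ->//; rewrite preimage_set0.
- by rewrite -preimage_bigcup; exact: mV.
Qed.

HB.instance Definition _ := isMeasure.Build _ _ _ lebesgue_cons
  lebesgue_cons0 lebesgue_cons_ge0 lebesgue_cons_sigma_additive.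

Let lebesgue_cons_sigma_finite : sigma_finite setT lebesgue_cons.
Proof.
have mh : measurable_fun [set: 'rV[R]_n.+1] (fun x : 'rV[R]_n.+1 => x ord0 ord0 : R).
  exact: measurable_rV_coord.
have mt : measurable_fun [set: 'rV[R]_n.+1]
    (fun x : 'rV[R]_n.+1 => \row_(i < n) x ord0 (lift ord0 i) : 'rV[R]_n).
  apply: measurable_fun_rV => i.
  rewrite (_ : (fun _ => _) = fun x : 'rV[R]_n.+1 => x ord0 (lift ord0 i)).
    exact: measurable_rV_coord.
  by apply/funext => x; rewrite mxE.
have /sigma_finiteP[F [FT ndF Foo]] := sigma_finiteT (@lebesgue_measure R).
have /sigma_finiteP[G [GT ndG Goo]] := sigma_finiteT mu.
pose g (x : 'rV[R]_n.+1) : measurableTypeR R * 'rV[R]_n :=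
  (x ord0 ord0, \row_(i < n) x ord0 (lift ord0 i)).
have gK : cancel rV_cons g.
  move=> [a x]; congr pair => /=.
    rewrite /rV_cons (_ : ord0 = lshift n (ord0 : 'I_1)); last exact/val_inj.
    by rewrite (@row_mxEl R 1 1 n) mxE eqxx.
  apply/rowP => i; rewrite mxE /rV_cons.
  rewrite (_ : lift ord0 i = rshift 1 i); last exact/val_inj.
  exact: (@row_mxEr R 1 1 n).
have mg : measurable_fun [set: 'rV[R]_n.+1] g by exact/measurable_fun_pair.
exists (fun k => g @^-1` (F k `*` G k)).
  apply/esym/seteqP; split=> // x _.
  have [n1 _ Fx] : (\bigcup_k F k) (g x).1 by rewrite -FT.
  have [n2 _ Gx] : (\bigcup_k G k) (g x).2 by rewrite -GT.
  exists (maxn n1 n2) => //; split.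
    by move: Fx; exact/subsetPset/ndF/leq_maxl.
  by move: Gx; exact/subsetPset/ndG/leq_maxr.
move=> k; have [mFk Fkoo] := Foo k; have [mGk Gkoo] := Goo k; split.
  by rewrite -[X in measurable X]setTI; apply: mg => //; exact: measurableX.
rewrite /lebesgue_cons /pushforward -comp_preimage (_ : g \o rV_cons = id).
  by rewrite preimage_id product_measure1E// lte_mul_pinfty// ge0_fin_numE.
exact/funext.
Qed.

HB.instance Definition _ := @Measure_isSigmaFinite.Build _ _ _ lebesgue_cons
  lebesgue_cons_sigma_finite.

End lebesgue_rV_step.

(* Lebesgue measure on R^n, as the iterated product of the one-dimensional
   one: 'rV_0 is a point and 'rV_m.+1 is R * 'rV_m. *)
Fixpoint lebesgue_rV {R : realType} (n : nat) :
    {sigma_finite_measure set 'rV[R]_n -> \bar R} :=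
  match n return {sigma_finite_measure set 'rV[R]_n -> \bar R} with
  | 0 => \d_(0 : 'rV[R]_0)
  | m.+1 => lebesgue_cons (lebesgue_rV m)
  end.

Record domain (R : realType) (N : nat) := Domain {
  domain_set :> set 'rV[R]_N;
  domain_open : open domain_set;
  domain_connected : connected domain_set;
  domain_nonempty : domain_set !=set0 }.
Arguments domain_open {R N} _.

Section smooth.
Context {R : realType} {N : nat}.
Implicit Types (phi : 'rV[R]_N -> R) (s : seq 'I_N).

(* Multi-indices are represented by the finite sequence s of the directions of
   differentiation: pderiv [:: i1; ...; ik] is d_i1 ... d_ik. *)
Definition pderiv s phi : 'rV[R]_N -> R :=
  foldr (fun i g => 'D_(delta_mx ord0 i) g) phi s.

Definition smooth phi :=
  forall s, continuous (pderiv s phi) /\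
    forall i x, derivable (pderiv s phi) x (delta_mx ord0 i).

Definition supp phi : set 'rV[R]_N := closure [set x | phi x != 0].

Definition laplacian phi : 'rV[R]_N -> R :=
  fun x => \sum_(i < N) pderiv [:: i; i] phi x.

End smooth.

Section domain_spaces.
Context {R : realType} {N : nat} (Om : domain R N).
Implicit Types (phi : 'rV[R]_N -> R) (s : seq 'I_N) (k : nat).

Definition mu_dom : {measure set 'rV[R]_N -> \bar R} :=
  mrestr (lebesgue_rV N) (open_measurable_rV (@domain_open R N Om)).

(* L^2(Omega): classes of almost everywhere equal functions; an element
   coerces to one of its representatives. *)
Definition L2 : Type := LspaceType mu_dom (lee1n 2).

Definition inner (u v : 'rV[R]_N -> R) : R := \int[mu_dom]_x (u x * v x).

(* Only used on square-integrable functions, where the norm is finite. *)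
Definition L2norm (u : 'rV[R]_N -> R) : R :=
  fine ('N[mu_dom]_(2%:E) [EFin \o u])%E.

Definition test_function phi :=
  [/\ smooth phi, compact (supp phi) & supp phi `<=` (Om : set _)].

Definition weak_pderiv s (u g : 'rV[R]_N -> R) :=
  forall phi, test_function phi ->
    inner u (pderiv s phi) = (- 1) ^+ size s * inner g phi.

Definition weak_laplacian (u g : 'rV[R]_N -> R) :=
  forall phi, test_function phi -> inner u (laplacian phi) = inner g phi.

Definition weak_bilaplacian (u f : 'rV[R]_N -> R) :=
  forall phi, test_function phi ->
    inner u (laplacian (laplacian phi)) = inner f phi.

(* D collects the weak derivatives of u of order at most k. *)
Definition weak_jet k (u : L2) (D : seq 'I_N -> L2) :=
  forall s, (size s <= k)%N -> weak_pderiv s u (D s).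

(* The H^k distance (sum_(j <= k) ||nabla^j (u - phi)||^2)^(1/2), where D
   collects the weak derivatives of u. *)
Definition sobolev_dist k (D : seq 'I_N -> L2) phi : R :=
  Num.sqrt (\sum_(j < k.+1) \sum_(s : j.-tuple 'I_N)
    L2norm (fun x => D s x - pderiv s phi x) ^+ 2).

(* Closure in H^k(Omega) of the test functions. *)
Definition sobolev0 k (u : L2) := exists2 D, weak_jet k u D &
  forall e : R, 0 < e ->
    exists2 phi, test_function phi & sobolev_dist k D phi < e.

Definition weak_gradient (u : L2) (G : 'I_N -> L2) :=
  forall i, weak_pderiv [:: i] u (G i).

Definition gradient_norm (G : 'I_N -> L2) : R :=
  Num.sqrt (\sum_(i < N) L2norm (G i) ^+ 2).

Definition friedrichs_bound (c : R) := forall u G,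
  sobolev0 1 u -> weak_gradient u G -> L2norm u <= c * gradient_norm G.

Definition friedrichs_admissible := exists2 c : R, 0 < c & friedrichs_bound c.

Definition friedrichs_const : R :=
  inf [set c : R | 0 < c /\ friedrichs_bound c].

(* Unbounded operators in L^2(Omega) are given by their graphs: T u f reads
   "u is in the domain of T and T u = f". *)
Definition operator := L2 -> L2 -> Prop.
Implicit Types S T : operator.

Definition op_dom T : set L2 := [set u | exists f, T u f].

Definition op_functional T := forall u f g, T u f -> T u g -> f = g.

Definition op_comp S T : operator := fun u f => exists2 g, T u g & S g f.

Definition op_inv T : operator := fun f u => T u f.

Definition op_bijective T :=
  (forall u v f, T u f -> T v f -> u = v) /\ (forall f, exists u, T u f).

Definition op_norm T : \bar R :=
  ereal_sup [set (L2norm p.2)%:E | p in [set p : L2 * L2 |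
    T p.1 p.2 /\ L2norm p.1 <= 1]].

Definition op_dense T := forall (v : L2) (e : R), 0 < e ->
  exists2 u : L2, op_dom T u & L2norm (fun x => v x - u x) < e.

Definition op_adjoint T : operator :=
  fun v w => forall u f, T u f -> inner f v = inner u w.

Definition op_selfadjoint T :=
  op_dense T /\ forall u f, T u f <-> op_adjoint T u f.

Definition op_positive T := forall u f : L2, T u f ->
  ~ ae_eq mu_dom setT (u : 'rV[R]_N -> R) (cst 0) -> 0 < inner f u.

(* -Delta on H(Delta, Omega) and on the closure of the test functions in
   H^2(Omega). *)
Definition opL : operator := fun u f => weak_laplacian u (fun x => - f x).

Definition opL0 : operator := fun u f => sobolev0 2 u /\ opL u f.

Definition biLaplacianD : operator := op_comp opL opL0.

(* <Delta u, Delta phi> = <f, phi> for all phi in the closure of the test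
   functions in H^2(Omega). *)
Definition variational_solution (f u : L2) :=
  exists2 g : L2, weak_laplacian u g &
    forall phi h : L2, sobolev0 2 phi -> weak_laplacian phi h ->
      inner g h = inner f phi.

End domain_spaces.

(* Main.v *)
Require Import Defs.
From HB Require Import structures.
From mathcomp Require Import all_boot all_order all_algebra.
From mathcomp Require Import all_classical all_reals all_analysis.
From mathcomp Require Import measurable_realfun ring lra.
Set Implicit Arguments.
Unset Strict Implicit.
Unset Printing Implicit Defensive.
Import Order.TTheory GRing.Theory Num.Theory.
Import numFieldNormedType.Exports.
Local Open Scope classical_set_scope.
Local Open Scope ring_scope.

(* On test functions, integration by parts and the Friedrichs inequality give
   |phi| <= c |grad phi|, |grad phi|^2 = - <phi, Lap phi> and
   |D^2 phi| = |Lap phi|, hence |phi| <= c^2 |Lap phi|, and |Lap phi| is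
   equivalent to the H^2 norm on the closure of the test functions. Minimising
   |Lap phi|^2 / 2 - <f, phi> over test functions therefore produces, by
   completeness of L^2, a solution u of Lap^2 u = f in that closure. So B_D is
   symmetric and surjective; injectivity and selfadjointness are formal
   consequences. Density of the domain is the same minimisation argument applied
   to <v, phi>, since a function orthogonal to all test functions vanishes. *)

(** * Square-integrable functions *)

(** The minimisation runs over the test functions themselves, not over a completed space: the
    minimising sequence is then already the approximating sequence that [sobolev0] asks for, and
    only derivatives of order at most two have to converge. Near-minimality at the rate 8^-n makes
    it Cauchy fast enough for a limit to exist pointwise almost everywhere. Directions of
    differentiation form ordered sequences, so |D^2 phi| = |Lap phi| rests on commuting mixed
    derivatives. This is obtained almost everywhere, by duality: the derivatives are moved onto
    products of one-variable bumps, where their order is immaterial, and these bumps suffice to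
    detect the zero class. [lebesgue_rV] is an iterated product, so integration by parts is an
    induction on the dimension through Fubini, ending in the fundamental theorem of calculus on a
    line. Test functions extend by zero to R^N, so the boundary of the domain never enters. *)

Section square_integrable.
Context d (T : measurableType d) (R : realType).
Variable mu : {measure set T -> \bar R}.
Implicit Types f g h : T -> R.

Definition sqint f := measurable_fun setT f /\
  mu.-integrable setT (EFin \o (fun x => f x ^+ 2)).

(* Convertible to [inner Om f g] for [mu := mu_dom Om]. *)
Definition ip f g : R := \int[mu]_x (f x * g x).

Lemma sqint_mul f g : sqint f -> sqint g ->
  mu.-integrable setT (EFin \o (fun x => f x * g x)).
Proof.
move=> [mf if2] [mg ig2].
apply: (@le_integrable _ _ _ mu setT _ _
  (EFin \o (fun x => f x ^+ 2 + g x ^+ 2))) => //.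
- by apply/measurable_EFinP; exact: measurable_funM.
- move=> x _ /=; rewrite lee_fin normrM.
  rewrite [leRHS]ger0_norm ?addr_ge0 ?sqr_ge0//.
  rewrite -(real_normK (num_real (f x))) -(real_normK (num_real (g x))).
  have := sqr_ge0 (`|f x| - `|g x|); have := sqr_ge0 (`|f x| + `|g x|); nra.
- exact: (@integrableD _ _ _ mu setT measurableT _ _ if2 ig2).
Qed.

Lemma sqint_dom (f g : T -> R) : measurable_fun setT f ->
  mu.-integrable setT (EFin \o g) -> (forall x, f x ^+ 2 <= g x) -> sqint f.
Proof.
move=> mf ig fg; split=> //.
apply: le_integrable ig => //.
  by apply/measurable_EFinP; exact: measurable_funX.
move=> x _ /=; rewrite lee_fin ger0_norm ?sqr_ge0//.
by rewrite (le_trans (fg x))// ler_norm.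
Qed.

Lemma sqint_lin (a b : R) f g : sqint f -> sqint g ->
  sqint (fun x => a * f x + b * g x).
Proof.
move=> [mf if2] [mg ig2].
apply: (@sqint_dom _ (fun x => (2 * a ^+ 2) * f x ^+ 2 + (2 * b ^+ 2) * g x ^+ 2)).
- by apply: measurable_funD; exact: measurable_funM.
- exact: (integrableD measurableT (integrableZl measurableT (2 * a ^+ 2) if2)
    (integrableZl measurableT (2 * b ^+ 2) ig2)).
(* The gap in (a f + b g)^2 <= 2 a^2 f^2 + 2 b^2 g^2 is exactly (a f - b g)^2. *)
- move=> x; have := sqr_ge0 (a * f x - b * g x).
  rewrite -subr_ge0 => h; rewrite -subr_ge0.
  by apply: le_trans h _; rewrite le_eqVlt; apply/orP; left; apply/eqP; ring.
Qed.

Lemma sqintD f g : sqint f -> sqint g -> sqint (fun x => f x + g x).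
Proof.
by move=> sf sg; have := sqint_lin 1 1 sf sg; under eq_fun do rewrite !mul1r.
Qed.

Lemma sqintZ (a : R) f : sqint f -> sqint (fun x => a * f x).
Proof.
move=> sf; have := sqint_lin a 0 sf sf.
by under eq_fun do rewrite mul0r addr0.
Qed.

Lemma sqintN f : sqint f -> sqint (fun x => - f x).
Proof. by move=> /(sqintZ (-1)); under eq_fun do rewrite mulN1r. Qed.

Lemma sqintB f g : sqint f -> sqint g -> sqint (fun x => f x - g x).
Proof. by move=> sf sg; apply: sqintD => //; exact: sqintN. Qed.

Lemma sqint0 : sqint (fun=> 0).
Proof.
split=> //; rewrite (_ : _ \o _ = cst 0%E); first exact: integrable0.
by apply/funext => x /=; rewrite expr0n.
Qed.

Lemma sqint_sum (I : Type) (r : seq I) (F : I -> T -> R) :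
  (forall i, sqint (F i)) -> sqint (fun x => \sum_(i <- r) F i x).
Proof.
move=> sF; elim: r => [|i r IH].
  by under eq_fun do rewrite big_nil; exact: sqint0.
by under eq_fun do rewrite big_cons; exact: sqintD.
Qed.

Lemma ipC f g : ip f g = ip g f.
Proof. by apply: eq_Rintegral => x _; rewrite mulrC. Qed.

Lemma ip_linl (a b : R) f g h : sqint f -> sqint g -> sqint h ->
  ip (fun x => a * f x + b * g x) h = a * ip f h + b * ip g h.
Proof.
move=> sf sg sh; rewrite /ip.
under eq_Rintegral do rewrite mulrDl -!mulrA.
rewrite RintegralD//; last 2 first.
- exact: (integrableZl measurableT a (sqint_mul sf sh)).
- exact: (integrableZl measurableT b (sqint_mul sg sh)).
by rewrite !RintegralZl//; exact: sqint_mul.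
Qed.

Lemma ipDl f g h : sqint f -> sqint g -> sqint h ->
  ip (fun x => f x + g x) h = ip f h + ip g h.
Proof.
move=> sf sg sh; have := ip_linl 1 1 sf sg sh; rewrite !mul1r => <-.
by under eq_fun do rewrite -[f _]mul1r -[g _]mul1r.
Qed.

Lemma ipZl (a : R) f h : sqint f -> sqint h ->
  ip (fun x => a * f x) h = a * ip f h.
Proof.
move=> sf sh; have := ip_linl a 0 sf sf sh; rewrite mul0r addr0 => <-.
by under [in RHS]eq_fun do rewrite mul0r addr0.
Qed.

Lemma ipNl f h : sqint f -> sqint h -> ip (fun x => - f x) h = - ip f h.
Proof.
move=> sf sh; rewrite -mulN1r -ipZl//.
by under [in RHS]eq_fun do rewrite mulN1r.
Qed.

Lemma ipBl f g h : sqint f -> sqint g -> sqint h ->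
  ip (fun x => f x - g x) h = ip f h - ip g h.
Proof. by move=> sf sg sh; rewrite ipDl ?ipNl//; exact: sqintN. Qed.

Lemma ipDr f g h : sqint f -> sqint g -> sqint h ->
  ip h (fun x => f x + g x) = ip h f + ip h g.
Proof. by move=> ? ? ?; rewrite ipC ipDl// ![ip h _]ipC. Qed.

Lemma ipBr f g h : sqint f -> sqint g -> sqint h ->
  ip h (fun x => f x - g x) = ip h f - ip h g.
Proof. by move=> ? ? ?; rewrite ipC ipBl// ![ip h _]ipC. Qed.

Lemma ip0l h : ip (fun=> 0) h = 0.
Proof.
rewrite /ip; under eq_Rintegral do rewrite mul0r.
by rewrite Rintegral_cst// mul0r.
Qed.

Lemma ip_suml (I : Type) (r : seq I) (F : I -> T -> R) h :
  (forall i, sqint (F i)) -> sqint h ->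
  ip (fun x => \sum_(i <- r) F i x) h = \sum_(i <- r) ip (F i) h.
Proof.
move=> sF sh; elim: r => [|i r IH].
  by rewrite big_nil; under eq_fun do rewrite big_nil; exact: ip0l.
rewrite big_cons -IH -ipDl//; last exact: sqint_sum.
by under eq_fun do rewrite big_cons.
Qed.

Lemma ip_sumr (I : Type) (r : seq I) (F : I -> T -> R) h :
  (forall i, sqint (F i)) -> sqint h ->
  ip h (fun x => \sum_(i <- r) F i x) = \sum_(i <- r) ip h (F i).
Proof.
by move=> sF sh; rewrite ipC ip_suml//; apply: eq_bigr => i _; rewrite ipC.
Qed.

Lemma ip_ge0 f : 0 <= ip f f.
Proof. by apply: Rintegral_ge0 => x _; rewrite -expr2 sqr_ge0. Qed.

Lemma sqint_ae f g : measurable_fun setT g ->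
  ae_eq mu setT f g -> sqint f -> sqint g.
Proof.
move=> mg fg [mf if2]; split => //; apply/integrableP; split.
  by apply/measurable_EFinP; exact: measurable_funX.
move/integrableP : if2 => [_]; apply: le_lt_trans.
rewrite le_eqVlt; apply/orP; left; apply/eqP/ae_eq_integral => //.
- by apply/measurable_EFinP/measurableT_comp => //; exact: measurable_funX.
- by apply/measurable_EFinP/measurableT_comp => //; exact: measurable_funX.
- by apply: filterS fg => x /(_ I) /= -> .
Qed.

Lemma ae_eq_ip f g h : measurable_fun setT f -> measurable_fun setT g ->
  measurable_fun setT h -> ae_eq mu setT f g -> ip f h = ip g h.
Proof.
move=> mf mg mh fg; congr fine; apply: ae_eq_integral => //.
- by apply/measurable_EFinP; exact: measurable_funM.
- by apply/measurable_EFinP; exact: measurable_funM.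
- by apply: filterS fg => x /(_ I) /= ->.
Qed.

Lemma ip_eq0 f : sqint f -> ip f f = 0 -> ae_eq mu setT f (cst 0).
Proof.
move=> [mf if2] f0.
have m2 : measurable_fun setT (EFin \o (fun x => f x ^+ 2)).
  by apply/measurable_EFinP; exact: measurable_funX.
have : (\int[mu]_x `|((f x ^+ 2)%R)%:E| = 0)%E.
  rewrite -(@fineK _ (integral _ _ _)); last first.
    by move/integrableP : if2 => [_ ?]; rewrite ge0_fin_numE// integral_ge0.
  congr EFin; rewrite -[RHS]f0; congr fine; apply: eq_integral => x _ /=.
  by rewrite ger0_norm ?sqr_ge0// expr2.
move/(ae_eq_integral_abs mu measurableT m2).
by apply: filterS => x /(_ I) /= [] /eqP; rewrite sqrf_eq0 => /eqP.
Qed.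

(** The discriminant bound, with two uses: Cauchy-Schwarz, and the first variation in the
    minimisation, where [a] bounds the distance of the functional to its infimum. *)
Lemma quadratic_ge0 (a b c : R) : 0 <= c ->
  (forall t, 0 <= a + 2 * t * b + t ^+ 2 * c) -> b ^+ 2 <= a * c.
Proof.
move=> c0 H; have [c00|cn0] := eqVneq c 0.
  have [->|b0] := eqVneq b 0; first by rewrite c00 mulr0 expr0n.
  (* For c = 0 the quadratic is affine in t, and this t gives it the value -1. *)
  have := H (- (a + 1) / (2 * b)); rewrite c00.
  have -> : a + 2 * (- (a + 1) / (2 * b)) * b
     + (- (a + 1) / (2 * b)) ^+ 2 * 0 = -1 by field.
  by rewrite ler0N1.
have {}c0 : 0 < c by rewrite lt_neqAle eq_sym cn0.
have := H (- b / c).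
have -> : a + 2 * (- b / c) * b + (- b / c) ^+ 2 * c = (a * c - b ^+ 2) / c by field.
by rewrite pmulr_lge0 ?invr_gt0// subr_ge0.
Qed.

Lemma cauchy_schwarz f g : sqint f -> sqint g -> ip f g ^+ 2 <= ip f f * ip g g.
Proof.
move=> sf sg; apply: quadratic_ge0; first exact: ip_ge0.
move=> t; have := ip_ge0 (fun x => 1 * f x + t * g x).
have sh := sqint_lin 1 t sf sg.
rewrite ip_linl// ![ip _ (fun x => 1 * f x + t * g x)]ipC !ip_linl// (ipC g f).
set A := ip f f; set B := ip f g; set C := ip g g.
by congr (0 <= _); ring.
Qed.

End square_integrable.

(** * Completeness of L^2 *)

Section completeness.
Context d (T : measurableType d) (R : realType).
Variable mu : {measure set T -> \bar R}.
Implicit Types f g h : T -> R.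

Lemma ae_eq_ip2 f f' g g' : measurable_fun setT f -> measurable_fun setT f' ->
  measurable_fun setT g -> measurable_fun setT g' ->
  ae_eq mu setT f f' -> ae_eq mu setT g g' -> ip mu f g = ip mu f' g'.
Proof.
move=> mf mf' mg mg' ff' gg'.
by rewrite (ae_eq_ip mf mf' mg ff') ipC (ae_eq_ip mg mg' mf' gg') ipC.
Qed.

(** The hypothesis bounds |u (k+1) - u k| by sqrt M / 2^k, so the telescoping series converges
    absolutely. *)
Lemma geometric_increment_cvg (u : R^nat) (M : R) :
  (forall k, 4 ^+ k * (u k.+1 - u k) ^+ 2 <= M) -> cvgn u.
Proof.
move=> uM.
have M0 : 0 <= M.
  by apply: le_trans (uM 0%N); rewrite expr0 mul1r sqr_ge0.
have uk k : `|u k.+1 - u k| <= Num.sqrt M / 2 ^+ k.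
  rewrite ler_pdivlMr ?exprn_gt0// -(ler_pXn2r (ltn0Sn 1)) ?nnegrE
    ?sqrtr_ge0// ?mulr_ge0 ?exprn_ge0//.
  rewrite sqr_sqrtr// exprMn real_normK ?num_real// -exprM mulnC exprM mulrC.
  by rewrite -natrX.
have : cvgn [series u k.+1 - u k]_k.
  apply: normed_cvg; apply: (@series_le_cvg _ _ (geometric (Num.sqrt M) 2^-1)).
  - by move=> k /=.
  - by move=> k; rewrite /geometric /= mulr_ge0 ?sqrtr_ge0 ?exprn_ge0.
  - by move=> k; rewrite /geometric /= exprVn; exact: uk.
  - by apply: is_cvg_geometric_series; rewrite ger0_norm// invf_lt1// ltr1n.
rewrite (_ : [series u k.+1 - u k]_k = fun n => u n - u 0%N); last first.
  by apply/funext => n; rewrite seriesEnat/= telescope_sumr.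
move=> cu; rewrite (_ : u = (fun n => (u n - u 0%N) + u 0%N)).
  by apply: is_cvgD => //; exact: is_cvg_cst.
by apply/funext => n; rewrite subrK.
Qed.

(* The weighted sum of 4^k |F_(k+1) - F_k|^2 is integrable, hence finite almost
   everywhere, which gives pointwise convergence; Fatou's lemma turns it into
   convergence in L^2. *)
Lemma rapid_cauchy_cvg (F : nat -> T -> R) (C : R) :
  (forall n, sqint mu (F n)) ->
  (forall n m, (n <= m)%N ->
     ip mu (fun x => F n x - F m x) (fun x => F n x - F m x) <= C / 8 ^+ n) ->
  exists2 f, sqint mu f &
    ip mu (fun x => F n x - f x) (fun x => F n x - f x) @[n --> \oo] --> 0.
Proof.
move=> sF cF.
have mF n : measurable_fun setT (F n) by have [] := sF n.
pose g k x := (4 ^+ k * (F k.+1 x - F k x) ^+ 2)%:E.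
have mg k : measurable_fun setT (g k).
  by apply/measurable_EFinP/measurable_funM => //; apply: measurable_funX;
    exact: measurable_funB.
have g0 k x : (0 <= g k x)%E by rewrite lee_fin mulr_ge0 ?sqr_ge0 ?exprn_ge0.
pose G x := (\sum_(k <oo) g k x)%E.
have C0 : 0 <= C.
  by have := cF 0%N 0%N (leqnn _); rewrite expr0 divr1; apply: le_trans; exact: ip_ge0.
(* The decay 8^-k of the hypothesis beats the weight 4^k and leaves 2^-k, which is summable. *)
have ig k : (\int[mu]_x g k x <= (C * (2 ^-1) ^+ k)%:E)%E.
  have sk : sqint mu (fun x => F k x - F k.+1 x) by exact: sqintB.
  rewrite /g; under eq_integral do rewrite EFinM.
  rewrite ge0_integralZl_EFin ?exprn_ge0//; last 2 first.
  - by move=> x _; rewrite lee_fin sqr_ge0.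
  - by apply/measurable_EFinP/measurable_funX; exact: measurable_funB.
  rewrite [X in (_ * X)%E](_ : _ = (ip mu (fun x => F k x - F k.+1 x)
      (fun x => F k x - F k.+1 x))%:E); last first.
    rewrite /ip /Rintegral fineK; last exact: (integrable_fin_num measurableT (sqint_mul sk sk)).
    by apply: eq_integral => x _; congr EFin; ring.
  rewrite -EFinM lee_fin mulrC -ler_pdivlMr ?exprn_gt0//.
  apply: le_trans (cF k k.+1 (leqnSn _)) _.
  rewrite le_eqVlt; apply/orP; left; apply/eqP.
  rewrite (_ : 8 = 2 * 4 :> R); last by ring.
  by rewrite exprMn exprVn invfM mulrA.
have mG : measurable_fun setT G by exact: ge0_emeasurable_sum.
have iG : (\int[mu]_x G x < +oo)%E.
  rewrite integral_nneseries//.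
  apply: (@le_lt_trans _ _ (\sum_(k <oo) (C * (2 ^-1) ^+ k)%:E)%E).
    by apply: lee_nneseries => // k _ _; exact: integral_ge0.
  rewrite (_ : (\sum_(k <oo) _)%E = limn (EFin \o series (geometric C 2^-1))).
    rewrite EFin_lim ?ltry//.
    by apply: is_cvg_geometric_series; rewrite ger0_norm// invf_lt1// ltr1n.
  congr (limn _); apply/funext => n /=; rewrite /series/= -sumEFin.
  by apply: eq_bigr.
have G0 x : (0 <= G x)%E by apply: nneseries_ge0.
pose A := [set x | (G x < +oo)%E].
have mA : measurable A.
  rewrite (_ : A = setT `&` [set x | G x != +oo%E]); last first.
    by apply/seteqP; split => x /=; rewrite /A/= ltey//; case.
  exact: emeasurable_neq.
have aeA : {ae mu, forall x, A x}.
  have : mu.-integrable setT G.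
    apply/integrableP; split => //.
    by under eq_integral do rewrite gee0_abs//.
  move=> /(integrable_ae measurableT); apply: filterS => x /(_ I).
  by rewrite ge0_fin_numE.
(* Cutting to the full-measure set where [G] is finite makes the sequence converge at every point,
   so that its pointwise limit is measurable. *)
pose F' n x := F n x * \1_A x.
have mF' n : measurable_fun setT (F' n) by apply: measurable_funM.
have FF' n : ae_eq mu setT (F n) (F' n).
  by apply: filterS aeA => x Ax _; rewrite /F' indicE mem_set// mulr1.
have sF' n : sqint mu (F' n) by apply: (sqint_ae _ (FF' n)).
have cF' x : cvgn (F' ^~ x).
  have [xA|xA] := pselect (A x); last first.
    rewrite (_ : F' ^~ x = cst 0); first exact: is_cvg_cst.
    by apply/funext => n; rewrite /F' indicE memNset// mulr0.
  apply: (@geometric_increment_cvg _ (fine (G x))) => k.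
  rewrite /F' indicE mem_set// !mulr1 -lee_fin fineK ?ge0_fin_numE//.
  apply: le_trans (nneseries_lim_ge k.+1 _) => //.
  by rewrite big_nat_recr//= leeDr// sume_ge0.
pose f x := limn (F' ^~ x).
have mf : measurable_fun setT f by exact: (measurable_fun_cvg mF').
have F'f x : F' ^~ x @ \oo --> f x by exact: cF'.
have Ff n : (\int[mu]_x ((F' n x - f x) ^+ 2)%:E <= (C / 8 ^+ n)%:E)%E.
  pose h m x := ((F' n x - F' m x) ^+ 2)%:E.
  have hE m : (\int[mu]_x h m x)%E =
      (ip mu (fun x => F n x - F m x) (fun x => F n x - F m x))%:E.
    have ae_h : ae_eq mu setT (fun x => F n x - F m x) (fun x => F' n x - F' m x).
      by apply: filterS2 (FF' n) (FF' m) => x + + xI => /(_ xI) -> /(_ xI) ->.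
    rewrite (ae_eq_ip2 _ _ _ _ ae_h ae_h); try exact: measurable_funB.
    have sh := sqintB (sF' n) (sF' m).
    rewrite /ip /Rintegral fineK; last exact: (integrable_fin_num measurableT (sqint_mul sh sh)).
    by apply: eq_integral => x _; rewrite -expr2.
  have -> : (fun x => ((F' n x - f x) ^+ 2)%:E) = (fun x => limn_einf (h ^~ x)).
    apply/funext => x; apply/esym.
    suff /cvg_limn_einf_sup[-> //] : h ^~ x @ \oo --> ((F' n x - f x) ^+ 2)%:E.
    apply: cvg_EFin; first exact: nearW.
    rewrite (_ : fine \o _ = (fun m => (F' n x - F' m x) ^+ 2))//.
    by under eq_fun do rewrite expr2; rewrite expr2;
      apply: cvgM; apply: cvgB => //; exact: cvg_cst.
  apply: le_trans (fatou _ _ _ _) _ => //.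
  - by move=> m; apply/measurable_EFinP/measurable_funX; exact: measurable_funB.
  - by move=> m x _; rewrite lee_fin sqr_ge0.
  rewrite limn_einf_lim; apply: lime_le.
    by apply/cvg_ex; eexists; exact/ereal_nondecreasing_cvgn/nondecreasing_einfs.
  (* The infimum over the indices m >= k is at most the value at [maxn k n], an index that is also
     at least n, as the hypothesis requires. *)
  apply: nearW => k; apply: (@le_trans _ _ (\int[mu]_x h (maxn k n) x)%E).
    by apply: ereal_inf_lbound; exists (maxn k n) => //=; exact: leq_maxl.
  by rewrite hE lee_fin; apply: cF; exact: leq_maxr.
have sd n : sqint mu (fun x => F' n x - f x).
  split; first exact: measurable_funB.
  apply/integrableP; split.
    by apply/measurable_EFinP/measurable_funX; exact: measurable_funB.
  under eq_integral do rewrite /= ger0_norm ?sqr_ge0//.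
  exact: le_lt_trans (Ff n) (ltry _).
have sf : sqint mu f.
  have := sqintB (sF' 0%N) (sd 0%N).
  by rewrite (_ : (fun x => _) = f)//; apply/funext => x; rewrite subKr.
exists f => //.
apply: (@squeeze_cvgr _ _ _ _ (cst 0) (geometric C 8^-1)).
- apply: nearW => n; rewrite ip_ge0/=.
  have ae_h : ae_eq mu setT (fun x => F n x - f x) (fun x => F' n x - f x).
    by apply: filterS (FF' n) => x + xI => /(_ xI) ->.
  rewrite (ae_eq_ip2 _ _ _ _ ae_h ae_h); try exact: measurable_funB.
  rewrite -lee_fin /ip /Rintegral fineK; last first.
    exact: (integrable_fin_num measurableT (sqint_mul (sd n) (sd n))).
  by rewrite exprVn; apply: le_trans (Ff n); under eq_integral do rewrite -expr2.
- exact: cvg_cst.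
- by apply: cvg_geometric; rewrite ger0_norm// invf_lt1// ltr1n.
Qed.

End completeness.

(** * Limits of inner products and of sums in L^2 *)

Section l2_convergence.
Context d (T : measurableType d) (R : realType).
Variable mu : {measure set T -> \bar R}.
Implicit Types (f g h : T -> R) (F G : nat -> T -> R).

Lemma norm_ip_le f g : sqint mu f -> sqint mu g ->
  `|ip mu f g| <= Num.sqrt (ip mu f f) * Num.sqrt (ip mu g g).
Proof.
move=> sf sg; rewrite -(ler_pXn2r (ltn0Sn 1)) ?nnegrE ?mulr_ge0 ?sqrtr_ge0//.
by rewrite real_normK ?num_real// exprMn !sqr_sqrtr ?ip_ge0//; exact: cauchy_schwarz.
Qed.

Definition cvg2 F f :=
  ip mu (fun x => F n x - f x) (fun x => F n x - f x) @[n --> \oo] --> 0.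

Lemma ip_cvg0 F G (c : R) : (forall n, sqint mu (F n)) ->
  (forall n, sqint mu (G n)) -> ip mu (F n) (F n) @[n --> \oo] --> 0 ->
  ip mu (G n) (G n) @[n --> \oo] --> c -> ip mu (F n) (G n) @[n --> \oo] --> 0.
Proof.
move=> sF sG F0 Gc; apply/norm_cvg0P.
apply: (@squeeze_cvgr _ _ _ _ (cst 0)
  (fun n => Num.sqrt (ip mu (F n) (F n)) * Num.sqrt (ip mu (G n) (G n)))).
- by apply: nearW => n; rewrite normr_ge0/=; exact: norm_ip_le.
- exact: cvg_cst.
- rewrite -(mul0r (Num.sqrt c)) -[X in X * _]sqrtr0; apply: cvgM.
    by apply: (cvg_comp _ _ F0); exact: sqrt_continuous.
  by apply: (cvg_comp _ _ Gc); exact: sqrt_continuous.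
Qed.

Lemma cvg2_ip F f G g : (forall n, sqint mu (F n)) -> sqint mu f ->
  (forall n, sqint mu (G n)) -> sqint mu g -> cvg2 F f -> cvg2 G g ->
  ip mu (F n) (G n) @[n --> \oo] --> ip mu f g.
Proof.
move=> sF sf sG sg Ff Gg.
have sFf n := sqintB (sF n) sf; have sGg n := sqintB (sG n) sg.
pose dF n x := F n x - f x; pose dG n x := G n x - g x.
rewrite (_ : (fun n => _) = fun n => ip mu (dF n) (dG n) + ip mu f (dG n) +
  ip mu (dF n) g + ip mu f g); last first.
  apply/funext => n; rewrite /dF /dG !(ipBl, ipBr)//.
  by ring.
rewrite -[X in _ --> X]add0r; apply: cvgD; last exact: cvg_cst.
rewrite -[X in _ --> X](addr0 0); apply: cvgD.
  rewrite -[X in _ --> X](addr0 0); apply: cvgD; first exact: ip_cvg0 Gg.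
  under eq_fun do rewrite ipC.
  by apply: (ip_cvg0 (c := ip mu f f)) => //; exact: cvg_cst.
by apply: (ip_cvg0 (c := ip mu g g)) => //; exact: cvg_cst.
Qed.

Lemma cvg2_cst f : cvg2 (fun=> f) f.
Proof.
rewrite /cvg2 (_ : (fun x : T => _) = (fun=> 0)).
  by rewrite ip0l; exact: cvg_cst.
by apply/funext => x; rewrite subrr.
Qed.

Lemma cvg2D F f G g : (forall n, sqint mu (F n)) -> sqint mu f ->
  (forall n, sqint mu (G n)) -> sqint mu g -> cvg2 F f -> cvg2 G g ->
  cvg2 (fun n x => F n x + G n x) (fun x => f x + g x).
Proof.
move=> sF sf sG sg Ff Gg.
pose dF n x := F n x - f x; pose dG n x := G n x - g x.
have sdF n : sqint mu (dF n) by exact: sqintB.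
have sdG n : sqint mu (dG n) by exact: sqintB.
rewrite /cvg2 (_ : (fun n => _) = fun n => ip mu (dF n) (dF n) +
  2 * ip mu (dF n) (dG n) + ip mu (dG n) (dG n)); last first.
  apply/funext => n.
  rewrite (_ : (fun x => _) = (fun x => dF n x + dG n x)); last first.
    by apply/funext => x; rewrite /dF /dG; ring.
  have sdD := sqintD (sdF n) (sdG n).
  by rewrite ipDl// !(ipDr (f := dF n))// (ipC mu (dG n) (dF n)); ring.
rewrite -[X in _ --> X]add0r; apply: cvgD => //.
rewrite -[X in _ --> X](addr0 0) ; apply: cvgD => //.
by rewrite -(mulr0 2); apply: cvgMl_tmp; exact: ip_cvg0 Gg.
Qed.

Lemma cvg2_sum (I : Type) (r : seq I) (F : nat -> I -> T -> R) (f : I -> T -> R) :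
  (forall n i, sqint mu (F n i)) -> (forall i, sqint mu (f i)) ->
  (forall i, cvg2 (F ^~ i) (f i)) ->
  cvg2 (fun n x => \sum_(i <- r) F n i x) (fun x => \sum_(i <- r) f i x).
Proof.
move=> sF sf Ff; elim: r => [|i r IH].
  rewrite (_ : (fun n x => _) = (fun=> fun=> 0)); last first.
    by apply/funext => n; apply/funext => x; rewrite big_nil.
  by rewrite (_ : (fun x => _) = (fun=> 0)); [exact: cvg2_cst|apply/funext => x; rewrite big_nil].
rewrite (_ : (fun n x => _) = (fun n x => F n i x + \sum_(j <- r) F n j x)); last first.
  by apply/funext => n; apply/funext => x; rewrite big_cons.
rewrite (_ : (fun x => _) = (fun x => f i x + \sum_(j <- r) f j x)); last first.
  by apply/funext => x; rewrite big_cons.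
exact: cvg2D (fun n => sF n i) (sf i) (fun n => sqint_sum r (sF n)) (sqint_sum r sf) (Ff i) IH.
Qed.

End l2_convergence.

(** * Square-integrable functions and their classes *)

Section l2_classes.
Context {R : realType} {N : nat} (Om : domain R N).
Implicit Types u v : L2 Om.
Local Notation mu := (mu_dom Om).

Lemma L2_sqint u : sqint mu u.
Proof.
have mu_ : measurable_fun setT (u : 'rV[R]_N -> R)
  by exact: (@measurable_funPT _ _ _ _ (repr (LebesgueSpace.sort u))).
split=> //; apply: Lfun2_integrable_sqr.
rewrite inE; apply/andP; split; first by rewrite inE.
by rewrite inE /=; exact: Lebesgue_finite.
Qed.

Lemma L2_ext u v : ae_eq mu setT u v -> u = v.
Proof.
move=> uv.
have : LebesgueSpace.sort u = LebesgueSpace.sort v.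
  rewrite -[LHS]reprK -[RHS]reprK; apply/eqP/ae_eqP.
  by apply: filterS uv => x /(_ I).
(* An element of [L2] is a quotient class packed with a proof that its norm is finite; once the
   classes agree, proof irrelevance identifies the rest. *)
case: u v {uv} => [u [[hu]]] [v [[hv]]] /= uv.
by move: hu hv; rewrite uv => hu hv; rewrite (Prop_irrelevance hu hv).
Qed.

Lemma sqint_finite_norm (f : 'rV[R]_N -> R) : sqint mu f -> finite_norm mu 2%:E f.
Proof.
move=> [mf /integrableP[_ if2]]; rewrite /finite_norm unlock poweR_lty//.
apply: le_lt_trans if2; rewrite le_eqVlt; apply/orP; left; apply/eqP.
apply: eq_integral => x _ /=; congr EFin.
by rewrite powR_mulrn// real_normK ?num_real// ger0_norm ?sqr_ge0.
Qed.

(** Converse of [L2_sqint]. All limits and test functions enter [L2] through it, which is why later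
    identities hold up to almost everywhere equality of a class with a given function. *)
Lemma sqint_L2 (f : 'rV[R]_N -> R) : sqint mu f ->
  exists u : L2 Om, ae_eq mu setT u f.
Proof.
move=> sf; have [mf _] := sf.
have mf' : @measurable_fun _ _ 'rV[R]_N (measurableTypeR R) setT f by exact: mf.
pose fm : {mfun 'rV[R]_N >-> measurableTypeR R} := HB.pack_for
  {mfun 'rV[R]_N >-> measurableTypeR R} f
  (isMeasurableFun.Build _ _ _ (measurableTypeR R) f mf').
pose q : {mfun_ mu, 'rV[R]_N >-> measurableTypeR R} :=
  (\pi_({mfun_ mu, 'rV[R]_N >-> measurableTypeR R}) fm)%qT.
have qf : ae_eq mu setT q f.
  have : (repr q == fm %[mod {mfun_ mu, 'rV[R]_N >-> measurableTypeR R}])%qT.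
    by rewrite reprK.
  by rewrite eqmodE => /asboolP H; apply: filterS H => x H _; exact: (H I).
have hq : finite_norm mu 2%:E q.
  apply: sqint_finite_norm; apply: (sqint_ae _ (ae_eq_sym qf) sf).
  exact: (@measurable_funPT _ _ _ _ (repr q)).
pose u : L2 Om := HB.pack_for (L2 Om) q (isFinLebesgue.Build _ _ _ mu _ (lee1n 2) q hq).
by exists u.
Qed.

Lemma L2normE (f : 'rV[R]_N -> R) : sqint mu f ->
  L2norm Om f = Num.sqrt (ip mu f f).
Proof.
move=> sf; rewrite /L2norm unlock /=.
rewrite (_ : (\int[mu]_x _)%E = (ip mu f f)%:E).
  by rewrite poweR_EFin/= powR12_sqrt// ip_ge0.
rewrite /ip /Rintegral fineK; last exact: (integrable_fin_num measurableT (sqint_mul sf sf)).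
apply: eq_integral => x _; by rewrite powR_mulrn// real_normK ?num_real// expr2.
Qed.

End l2_classes.

(* A minimising sequence of [a u u - 2 * l u]; the parallelogram identity makes
   it Cauchy and the first variation makes it converge to a representative of
   [l]. *)
Section minimisation.
Context (T : Type) (R : realType).
Implicit Types u v w : T -> R.
Variables (S : set (T -> R)) (a : (T -> R) -> (T -> R) -> R) (l : (T -> R) -> R).
Variable K : R.
Hypothesis S_nonempty : S !=set0.
Hypothesis S_lin : forall s t u v, S u -> S v -> S (fun x => s * u x + t * v x).
Hypothesis a_lin : forall s t u v w, S u -> S v -> S w ->
  a (fun x => s * u x + t * v x) w = s * a u w + t * a v w.
Hypothesis a_sym : forall u v, S u -> S v -> a u v = a v u.
Hypothesis a_ge0 : forall u, S u -> 0 <= a u u.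
Hypothesis l_lin : forall s t u v, S u -> S v ->
  l (fun x => s * u x + t * v x) = s * l u + t * l v.
Hypothesis K_ge0 : 0 <= K.
Hypothesis l_bounded : forall u, S u -> l u ^+ 2 <= K * a u u.

Let J u := a u u - 2 * l u.

Let J_lin s t u v : S u -> S v -> J (fun x => s * u x + t * v x) =
  s ^+ 2 * a u u + 2 * s * t * a u v + t ^+ 2 * a v v - 2 * (s * l u + t * l v).
Proof.
move=> Su Sv; have Sw := S_lin s t Su Sv.
rewrite /J l_lin// a_lin// (a_sym Su Sw) (a_sym Sv Sw) !a_lin// (a_sym Sv Su).
by congr (_ - _); ring.
Qed.

(** Arithmetic-geometric means: (l u)^2 <= K a u u gives 2 |l u| <= K + a u u. *)
Let J_lb u : S u -> - K <= J u.
Proof.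
move=> Su; have := l_bounded Su; have := a_ge0 Su; rewrite /J.
move: (l u) (a u u) => x y y0 xy.
rewrite -lerBlDr opprK addrC.
have : `|2 * x| <= `|y + K|.
  rewrite -ler_sqr ?nnegrE// !real_normK ?num_real//.
  rewrite -subr_ge0; have -> : (y + K) ^+ 2 - (2 * x) ^+ 2 = (y - K) ^+ 2 + 4 * (K * y - x ^+ 2) by ring.
  by rewrite addr_ge0 ?sqr_ge0// mulr_ge0// subr_ge0.
rewrite (ger0_norm (addr_ge0 y0 K_ge0)) => /(le_trans (ler_norm _)); lra.
Qed.

Lemma minimising_sequence : exists2 phi : nat -> T -> R, forall n, S (phi n) &
  (exists C, forall n m, (n <= m)%N ->
    a (fun x => 1 * phi n x + -1 * phi m x) (fun x => 1 * phi n x + -1 * phi m x)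
      <= C / 8 ^+ n) /\
  (forall psi, S psi -> a (phi n) psi @[n --> \oo] --> l psi).
Proof.
pose E := [set J u | u in S].
have E0 : E !=set0 by have [u Su] := S_nonempty; exists (J u), u.
have Elb : has_lbound E by exists (- K) => _ [u Su <-]; exact: J_lb.
pose m := inf E.
have mJ u : S u -> m <= J u by move=> Su; apply: ge_inf => //; exists u.
(* The rate 8^-n is the one that [rapid_cauchy_cvg] consumes. *)
have /choice[phi phiP] : forall n : nat, exists u, S u /\ J u < m + (8 ^+ n)^-1.
  move=> n; have e0 : 0 < (8 ^+ n)^-1 :> R by rewrite invr_gt0 exprn_gt0.
  have [_ [u Su <-] Ju] := inf_adherent e0 (conj E0 Elb).
  by exists u.
exists phi; first by move=> n; have [] := phiP n.
split.
  (* Parallelogram identity: a (p - q) (p - q) = 2 J p + 2 J q - 4 J ((p + q) / 2). Since J is at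
     least m at the midpoint, this is at most 2 / 8^p + 2 / 8^q <= 4 / 8^p. *)
  exists 4 => p q pq; have [Sp Jp] := phiP p; have [Sq Jq] := phiP q.
  have Sd := S_lin 1 (-1) Sp Sq.
  have := mJ _ (S_lin 2^-1 2^-1 Sp Sq); rewrite J_lin//.
  rewrite a_lin// (a_sym Sp Sd) (a_sym Sq Sd) !a_lin// (a_sym Sq Sp).
  have : (8 ^+ q)^-1 <= (8 ^+ p)^-1 :> R.
    by rewrite lef_pV2 ?posrE ?exprn_gt0// ler_eXn2l// ltr1n.
  move: Jp Jq; rewrite /J.
  move: (a (phi p) (phi p)) (a (phi q) (phi q)) (a (phi p) (phi q)) => x y z.
  move: (l (phi p)) (l (phi q)) (_^-1) (_^-1) => x' y' e e'; lra.
move=> psi Spsi.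
(* For every t, m <= J (phi n + t psi) = J (phi n) + 2 t (a (phi n) psi - l psi) + t^2 a psi psi,
   while J (phi n) < m + 8^-n; the discriminant bound then applies. *)
have r2 n : (a (phi n) psi - l psi) ^+ 2 <= (8 ^+ n)^-1 * a psi psi.
  have [Sn Jn] := phiP n.
  apply: quadratic_ge0; first exact: a_ge0.
  move=> t; have := mJ _ (S_lin 1 t Sn Spsi); rewrite J_lin//.
  by move: Jn; rewrite /J; set e := _^-1; lra.
apply/subr_cvg0/norm_cvg0P.
apply: (@squeeze_cvgr _ _ _ _ (cst 0)
  (fun n => Num.sqrt (geometric (a psi psi) 8^-1 n))).
- apply: nearW => n; rewrite normr_ge0/= -sqrtr_sqr ler_wsqrtr//.
  by rewrite /geometric/= exprVn mulrC.
- exact: cvg_cst.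
- rewrite -sqrtr0; apply: cvg_comp; last exact: sqrt_continuous.
  by apply: cvg_geometric; rewrite ger0_norm// invf_lt1// ltr1n.
Qed.

End minimisation.

(** * Integration by parts for test functions *)

Section line_derivative.
Context {R : realType} (V : normedModType R).
Implicit Types (h : V -> R) (x e : V).

Lemma derive_near0 h x e : (\near x, h x = 0) -> 'D_e h x = 0.
Proof.
move=> h0; rewrite (@near_eq_derive _ _ _ h (cst 0))// derive_cst//.
Qed.

End line_derivative.

(** A directional derivative sees only the restriction to a line. This is how derivatives on R^(n+1)
    are identified with those of slices, whether the slice is a copy of R^n or of R. *)
Lemma line_quotient {R : realType} {V W : normedModType R} (h : V -> R) (g : W -> R)
    x e y e' : (forall s, g (y + s *: e') = h (x + s *: e)) ->
  (fun k : R => k^-1 *: ((g \o shift y) (k *: e') - g y)) =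
  (fun k : R => k^-1 *: ((h \o shift x) (k *: e) - h x)).
Proof.
move=> gh; apply/funext => k /=.
have := gh 0; rewrite !scale0r !addr0 => ->.
by rewrite (addrC (k *: e')) gh (addrC x).
Qed.

Lemma derive_line {R : realType} {V W : normedModType R} (h : V -> R) (g : W -> R)
    x e y e' : (forall s, g (y + s *: e') = h (x + s *: e)) ->
  'D_e' g y = 'D_e h x.
Proof. by move=> gh; rewrite /derive (line_quotient gh). Qed.

Lemma derivable_line {R : realType} {V W : normedModType R} (h : V -> R) (g : W -> R)
    x e y e' : (forall s, g (y + s *: e') = h (x + s *: e)) ->
  derivable h x e -> derivable g y e'.
Proof. by move=> gh; rewrite /derivable (line_quotient gh). Qed.

Lemma supp_derive {R : realType} {N : nat} (h : 'rV[R]_N -> R) (e : 'rV[R]_N) :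
  [set x | 'D_e h x != 0] `<=` supp h.
Proof.
move=> x; apply: contraPP => xh; apply/negP; rewrite negbK; apply/eqP.
apply: derive_near0.
have : nbhs x (~` supp h) by apply: open_nbhs_nbhs; split => //; exact/closed_openC/closed_closure.
apply: filterS => y yh; apply/eqP; apply: contra_notT yh => hy.
exact: subset_closure.
Qed.

(** * Cubes, and the splitting of R^(n+1) into R times R^n *)

Section boxes.
Context {R : realType}.

Definition cube n (r : R) : set 'rV[R]_n := [set x | forall i, `|x ord0 i| <= r].

Lemma closed_cube n r : closed (@cube n r).
Proof.
rewrite (_ : cube r = \bigcap_(i in setT) ((fun x : 'rV[R]_n => `|x ord0 i|) @^-1` [set y | y <= r])).
  apply: closed_bigI => i _; apply: closed_comp; last exact: closed_le.
  by move=> x _; apply: continuous_comp; [exact: coord_continuous|exact: norm_continuous].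
by apply/seteqP; split => x /= H i; [move=> _|]; exact: H.
Qed.

Lemma measurable_cube n r : measurable (@cube n r : set 'rV[R]_n).
Proof.
rewrite -[X in measurable X]setCK; apply: measurableC.
by apply: open_measurable_rV; apply: closed_openC; exact: closed_cube.
Qed.

Lemma rV_cons0 n (p : measurableTypeR R * 'rV[R]_n) : rV_cons p ord0 ord0 = p.1.
Proof.
rewrite /rV_cons (_ : ord0 = lshift n (ord0 : 'I_1)); last exact/val_inj.
by rewrite (@row_mxEl R 1 1 n) mxE eqxx.
Qed.

Lemma rV_consS n (p : measurableTypeR R * 'rV[R]_n) i :
  rV_cons p ord0 (lift ord0 i) = p.2 ord0 i.
Proof.
rewrite /rV_cons (_ : lift ord0 i = rshift 1 i); last exact/val_inj.
by rewrite (@row_mxEr R 1 1 n).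
Qed.

Lemma rV_consP n (x y : 'rV[R]_n.+1) : x ord0 ord0 = y ord0 ord0 ->
  (forall i, x ord0 (lift ord0 i) = y ord0 (lift ord0 i)) -> x = y.
Proof.
move=> xy0 xyS; apply/rowP => i; case: (unliftP ord0 i) => [j ->|->]; first exact: xyS.
exact: xy0.
Qed.

Lemma addZdeltaE n (x : 'rV[R]_n) s j i :
  (x + s *: delta_mx ord0 j) ord0 i = x ord0 i + s * (i == j)%:R.
Proof. by rewrite !mxE eqxx. Qed.

Lemma rV_consD0 n t s (x : 'rV[R]_n) :
  rV_cons (t, x) + s *: delta_mx ord0 ord0 = rV_cons (t + s, x).
Proof.
apply: rV_consP => [|i]; rewrite addZdeltaE !(rV_cons0, rV_consS) /=.
  by rewrite mulr1.
by rewrite mulr0 addr0.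
Qed.

Lemma rV_consDS n t s (x : 'rV[R]_n) j :
  rV_cons (t, x) + s *: delta_mx ord0 (lift ord0 j) =
  rV_cons (t, x + s *: delta_mx ord0 j).
Proof.
apply: rV_consP => [|i]; rewrite addZdeltaE !(rV_cons0, rV_consS) /=.
  by rewrite mulr0 addr0.
by rewrite addZdeltaE (inj_eq lift_inj).
Qed.

Lemma rV_cons_cube n r : (@rV_cons R n) @^-1` cube r = `[-r, r]%classic `*` cube r.
Proof.
apply/seteqP; split => -[t x] /=.
  move=> H; split => [|i].
    by have := H ord0; rewrite rV_cons0/= in_itv/= ler_norml.
  by have := H (lift ord0 i); rewrite rV_consS.
rewrite in_itv/= -ler_norml => -[tr xr] i.
by case: (unliftP ord0 i) => [j ->|->]; rewrite (rV_cons0, rV_consS).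
Qed.

Lemma lebesgue_cube n r : (lebesgue_rV n (@cube n r) < +oo)%E.
Proof.
elim: n => [|n IH] /=.
  by rewrite diracE; case: (_ \in _); exact: ltry.
rewrite /lebesgue_cons /pushforward rV_cons_cube product_measure1E//; last exact: measurable_cube.
rewrite lte_mul_pinfty//.
  rewrite (_ : _ `[- r, r]%classic = lebesgue_measure [set` `[- r, r]])//.
  by rewrite lebesgue_measure_itv; case: ifP.
Qed.

End boxes.

Lemma integrable_indic_lty d (T : measurableType d) (R : realType)
    (mu : {measure set T -> \bar R}) (A : set T) :
  measurable A -> (mu A < +oo)%E -> mu.-integrable setT (EFin \o (\1_A : T -> R)).
Proof.
move=> mA muA; apply/integrableP; split.
  by apply/measurable_EFinP; exact: measurable_indic.
under eq_integral do rewrite /= ger0_norm//.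
by rewrite integral_indic// setIT.
Qed.

Section continuous_bounded_support.
Context {R : realType} {n : nat}.
Implicit Types (f h : 'rV[R]_n -> R) (r : R).

(** Bounded support in a form that the slices t, x of [rV_cons] inherit with the same r. *)
Definition support_in_cube f r := forall x, f x != 0 -> cube r x.

Lemma continuous_measurable_rV f : continuous f -> measurable_fun setT f.
Proof.
move=> /continuousP cf; apply: (measurability _ (RGenOpens.measurableE R)).
move=> _ [_ [a [b ->] <-]]; rewrite setTI; apply: open_measurable_rV.
exact/cf/interval_open.
Qed.

Lemma compact_cube r : compact (@cube R n r).
Proof.
rewrite (_ : cube r = [set x : 'rV[R]_n | forall i, `[-r, r]%classic (x ord0 i)]).
  by apply: (@rV_compact R n (fun=> `[- r, r]%classic)) => i; exact: segment_compact.
by apply/seteqP; split => x /= H i; have := H i; rewrite in_itv/= ler_norml.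
Qed.

Lemma continuous_support_bounded f r : continuous f -> support_in_cube f r ->
  exists M : R, forall x, `|f x| <= M.
Proof.
move=> cf fr.
have /compact_bounded /pinfty_ex_gt0[M _ fM] : compact (f @` cube r).
  by apply: continuous_compact; [exact: continuous_subspaceT|exact: compact_cube].
exists (Num.max 0 M) => x; have [->|fx] := eqVneq (f x) 0.
  by rewrite normr0 le_max lexx.
by rewrite le_max; apply/orP; right; apply: (fM (f x)); exists x => //; exact: fr.
Qed.

Lemma integrable_support_in_cube (mu : {measure set 'rV[R]_n -> \bar R}) f r (M : R) :
  measurable_fun setT f -> support_in_cube f r -> (forall x, `|f x| <= M) ->
  (mu (cube r) < +oo)%E -> mu.-integrable setT (EFin \o f).
Proof.
move=> mf fr fM mur.
have M0 : 0 <= M by rewrite (le_trans _ (fM 0)).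
have ic : mu.-integrable setT (EFin \o (fun x => M * \1_(cube r) x)).
  apply: (integrableZl measurableT M (f := EFin \o \1_(cube r))).
  by apply: integrable_indic_lty => //; exact: measurable_cube.
apply: le_integrable ic => //; first exact/measurable_EFinP.
move=> x _; rewrite lee_fin indicE; have [->|fx] := eqVneq (f x) 0.
  by rewrite normr0.
by rewrite mem_set ?mulr1 ?(ger0_norm M0)//; exact: fr.
Qed.

Lemma supp_support_in_cube f r : support_in_cube f r -> supp f `<=` cube r.
Proof.
move=> fr; apply: (@subset_trans _ (closure (cube r))).
  by apply: closure_subset => x; exact: fr.
by rewrite -(closure_id _).1//; exact: closed_cube.
Qed.

Lemma compact_support_in_cube f : compact (supp f) -> exists r, support_in_cube f r.
Proof.
move=> /compact_bounded /pinfty_ex_gt0[M _ fM]; exists M => x fx i.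
apply: (@le_trans _ _ `|x|); last by apply: fM; exact: subset_closure.
by rewrite [leRHS]mx_normrE; apply: (le_bigmax _ (fun ij => `|x ij.1 ij.2|) (ord0, i)).
Qed.

Lemma derive_support_in_cube f e r : support_in_cube f r ->
  support_in_cube ('D_e f) r.
Proof. by move=> fr x /supp_derive /(supp_support_in_cube fr). Qed.

End continuous_bounded_support.

Lemma integral_derive_support {R : realType} (g : R -> R) (r : R) :
  (forall t : R, derivable g t 1) -> continuous (derive1 g) ->
  (forall t, g t != 0 -> `|t| <= r) ->
  (\int[lebesgue_measure]_t (derive1 g t)%:E = 0)%E.
Proof.
move=> dg cg' gr.
have cg : continuous g.
  by move=> t; apply/differentiable_continuous/derivable1_diffP.
(* Strictly beyond r, and positive: g vanishes at both ends of [-s, s], and it vanishes near every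
   point outside that interval. *)
pose s : R := `|r| + 1.
have s0 : 0 < s by rewrite ltr_pwDr.
have rs : r < s by rewrite (le_lt_trans (ler_norm _))// ltrDl.
have gs t : s <= `|t| -> g t = 0.
  by move=> st; apply/eqP; apply: contraTT st => /gr; rewrite -ltNge => /le_lt_trans; apply.
have g's (t : R) : `[- s, s]%classic t \/ derive1 g t = 0.
  have [|st] := leP `|t| s; first by rewrite ler_norml; left.
  right; rewrite derive1E; apply: derive_near0.
  have ot : open_nbhs t (~` [set y : R | `|y| <= s]).
    split; last by apply/negP; rewrite -ltNge.
    apply: closed_openC; apply: (closed_comp _ (@closed_le R s)).
    by move=> x _; exact: norm_continuous.
  apply: filterS (open_nbhs_nbhs ot) => y /= /negP; rewrite -ltNge => /ltW; exact: gs.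
transitivity (\int[lebesgue_measure]_(t in `[(- s)%R, s]) (derive1 g t)%:E)%E.
  rewrite [RHS]integral_mkcond; apply: eq_integral => t _.
  rewrite patchE; case: ifPn => //; rewrite notin_setE => tn.
  by have [//|->] := g's t.
rewrite (@continuous_FTC2 _ _ g).
- by rewrite !gs ?subee// ?normrN ger0_norm// ltW.
- by rewrite gtrN.
- exact: continuous_subspaceT.
- split; first by move=> t _.
  + by apply: cvg_at_right_filter; exact: cg.
  + by apply: cvg_at_left_filter; exact: cg.
- by move=> t _.
Qed.

Lemma continuous_rV_consr {R : realType} n (t : R) :
  continuous (fun x : 'rV[R]_n => rV_cons (t, x)).
Proof.
move=> x A /nbhs_ballP[e /= e0 eA].
apply: filterS (nbhsx_ballx x e e0) => y [_ xy]; apply: eA; split => // i j.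
rewrite [i]ord1; case: (unliftP ord0 j) => [k ->|->].
  by rewrite !rV_consS; exact: xy.
by rewrite !rV_cons0; exact: ballxx.
Qed.

Lemma continuous_rV_consl {R : realType} n (x : 'rV[R]_n) :
  continuous (fun t : R => rV_cons (t, x)).
Proof.
move=> t A /nbhs_ballP[e /= e0 eA].
apply: filterS (nbhsx_ballx t e e0) => s ts; apply: eA; split => // i j.
rewrite [i]ord1; case: (unliftP ord0 j) => [k ->|->].
  by rewrite !rV_consS; exact: ballxx.
by rewrite !rV_cons0.
Qed.

(** Induction along the definition of [lebesgue_rV]. If i is a later coordinate, Fubini integrates
    first over R^n and the induction hypothesis kills every slice; if i is the first coordinate, the
    inner integral is over R and vanishes by the fundamental theorem of calculus. *)
Lemma integral_partial_eq0 {R : realType} n (i : 'I_n) (h : 'rV[R]_n -> R) (r : R) :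
  continuous h -> continuous ('D_(delta_mx ord0 i) h) ->
  (forall x, derivable h x (delta_mx ord0 i)) -> support_in_cube h r ->
  (\int[lebesgue_rV n]_x ('D_(delta_mx ord0 i) h x)%:E = 0)%E.
Proof.
elim: n i h => [[]//|n IH] i h ch ch' dh hr.
set f := 'D_(delta_mx ord0 i) h.
have mf : measurable_fun setT f by exact: continuous_measurable_rV.
have [M fM] := continuous_support_bounded ch' (derive_support_in_cube hr).
pose F : measurableTypeR R * 'rV[R]_n -> \bar R := EFin \o (f \o @rV_cons R n).
have mF : measurable_fun setT F.
  by apply/measurable_EFinP; apply: measurableT_comp => //; exact: measurable_rV_cons.
(* Fubini needs integrability on the product: the derivative is bounded by M and vanishes off the
   preimage of a cube, which has finite measure. *)
have iF : (lebesgue_measure \x lebesgue_rV n)%E.-integrable setT F.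
  have ic : (lebesgue_measure \x lebesgue_rV n)%E.-integrable setT
      (EFin \o (fun x => M * \1_((@rV_cons R n) @^-1` cube r) x)).
    apply: (integrableZl measurableT M (f := EFin \o \1_((@rV_cons R n) @^-1` cube r))).
    apply: integrable_indic_lty.
      rewrite -[X in measurable X]setTI; apply: measurable_rV_cons => //.
      exact: measurable_cube.
    exact: (lebesgue_cube n.+1 r).
  apply: le_integrable ic => //.
  move=> x _; rewrite /= lee_fin indicE.
  have M0 : 0 <= M by rewrite (le_trans _ (fM 0)).
  have [->|fx] := eqVneq (f (rV_cons x)) 0; first by rewrite normr0.
  rewrite mem_set ?mulr1 ?(ger0_norm M0); first exact: fM.
  exact: (derive_support_in_cube hr fx).
transitivity (\int[lebesgue_measure \x lebesgue_rV n]_z F z)%E.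
  have := integral_pushforward (@measurable_rV_cons R n)
    (f := EFin \o f) (D := setT) (mu := (lebesgue_measure \x lebesgue_rV n)%E).
  rewrite preimage_setT => <- //.
  exact/measurable_EFinP.
case: (unliftP ord0 i) => [j ij|i0].
- rewrite -integral12_prod_meas1//; apply: integral0_eq => t _.
  rewrite /fubini_F.
  pose g (x : 'rV[R]_n) := h (rV_cons (t, x)).
  have gx s x : g (x + s *: delta_mx ord0 j) = h (rV_cons (t, x) + s *: delta_mx ord0 i).
    by rewrite /g ij rV_consDS.
  have gE x : f (rV_cons (t, x)) = 'D_(delta_mx ord0 j) g x.
    by apply: derive_line => s; rewrite gx.
  under eq_integral => x _ do rewrite /F /= gE.
  apply: IH.
  + move=> x; apply: continuous_comp; last exact: ch.
    exact: continuous_rV_consr.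
  + rewrite (_ : 'D__ g = fun x => f (rV_cons (t, x))); last by apply/funext => x; rewrite gE.
    move=> x; apply: (continuous_comp (f := fun x : 'rV[R]_n => rV_cons (t, x))); last exact: ch'.
    exact: continuous_rV_consr.
  + by move=> x; apply: (derivable_line _ (dh (rV_cons (t, x)))) => s; rewrite gx.
  + move=> x /hr; rewrite -[cube r _]/((@rV_cons R n @^-1` cube r) (t, x)).
    by rewrite rV_cons_cube => -[].
- rewrite -integral21_prod_meas1//; apply: integral0_eq => x _.
  rewrite /fubini_G.
  pose g (t : R) := h (rV_cons (t, x)).
  have gt s t : g (t + s *: 1) = h (rV_cons (t, x) + s *: delta_mx ord0 i).
    by rewrite i0 rV_consD0 [s *: 1]mulr1.
  have gE t : f (rV_cons (t, x)) = derive1 g t.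
    by rewrite derive1E; apply: derive_line => s; rewrite gt.
  under eq_integral => t _ do rewrite /F /= gE.
  apply: (integral_derive_support (r := r)).
  + by move=> t; apply: (derivable_line _ (dh (rV_cons (t, x)))) => s; rewrite gt.
  + rewrite (_ : derive1 g = fun t => f (rV_cons (t, x))); last by apply/funext => t; rewrite gE.
    move=> t; apply: (continuous_comp (f := fun t : R => rV_cons (t, x))); last exact: ch'.
    exact: continuous_rV_consl.
  + move=> t /hr; rewrite -[cube r _]/((@rV_cons R n @^-1` cube r) (t, x)).
    by rewrite rV_cons_cube => -[/=]; rewrite in_itv/= ler_norml.
Qed.

(** * Test functions on a domain *)

Section test_functions.
Context {R : realType} {N : nat} (Om : domain R N).
Implicit Types (phi psi : 'rV[R]_N -> R) (s : seq 'I_N).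
Local Notation mu := (mu_dom Om).
Local Notation e i := (delta_mx ord0 i : 'rV[R]_N).

Lemma mrestr_cube (D : set 'rV[R]_N) (mD : measurable D) r :
  (mrestr (lebesgue_rV N) mD (cube r) < +oo)%E.
Proof.
apply: le_lt_trans (lebesgue_cube N r); have mr := @measurable_cube R N r.
by apply: le_measure; rewrite ?inE//; exact: measurableI.
Qed.

(** [mu_dom] is a restricted measure on all of R^N, so Lebesgue measure is its sum with the
    restriction to the complement of the domain, for which f is zero almost everywhere. *)
Lemma integral_mu_dom (f : 'rV[R]_N -> R) (r M : R) : measurable_fun setT f ->
  support_in_cube f r -> (forall x, `|f x| <= M) ->
  (forall x, f x != 0 -> domain_set Om x) ->
  (\int[mu]_x (f x)%:E = \int[lebesgue_rV N]_x (f x)%:E)%E.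
Proof.
move=> mf fr fM fO.
have mO := open_measurable_rV (domain_open Om).
have mC := measurableC mO.
pose nu := mrestr (lebesgue_rV N) mC.
have mf' : measurable_fun setT (EFin \o f) by exact/measurable_EFinP.
have nu0 : ae_eq nu setT (EFin \o f) (cst 0%E).
  exists (domain_set Om); split => //.
    by rewrite /nu /= /mrestr setICr measure0.
  by move=> x /= fx; apply: fO; apply: contra_notN fx => /eqP ->.
rewrite [RHS](@eq_measure_integral _ _ _ _ (measure_add mu nu)); last first.
  move=> A mA _; transitivity (mu A + nu A)%E; last exact/esym/measure_addE.
  rewrite /= /nu /mrestr -measureU.
  - by rewrite -setIUr setUCr setIT.
  - exact: measurableI.
  - exact: measurableI.
  - by rewrite setIACA setICr setI0.
rewrite integral_measure_add//; last 2 first.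
- by apply: (integrable_support_in_cube mf fr fM); exact: mrestr_cube.
- by apply: (integrable_support_in_cube mf fr fM); exact: mrestr_cube.
by rewrite [X in (_ + X)%E](ae_eq_integral (cst 0%E))// integral0 adde0.
Qed.

Lemma continuous_sqint (f : 'rV[R]_N -> R) r : continuous f ->
  support_in_cube f r -> sqint mu f.
Proof.
move=> cf fr; have [M fM] := continuous_support_bounded cf fr.
have mf := continuous_measurable_rV cf.
split => //; apply: (@integrable_support_in_cube _ _ _ _ r (M ^+ 2)).
- exact: measurable_funX.
- by move=> x; rewrite sqrf_eq0; exact: fr.
- by move=> x; rewrite ger0_norm ?sqr_ge0// -real_normK ?num_real// lerXn2r ?nnegrE// (le_trans _ (fM x)).
- exact: mrestr_cube.
Qed.

Lemma pderiv_cat s s' phi : pderiv (s ++ s') phi = pderiv s (pderiv s' phi).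
Proof. exact: foldr_cat. Qed.

Lemma smooth_pderiv s phi : smooth phi -> smooth (pderiv s phi).
Proof. by move=> sp s'; rewrite -pderiv_cat; exact: sp. Qed.

Lemma supp_pderiv s phi : supp (pderiv s phi) `<=` supp phi.
Proof.
elim: s => //= i s IH; apply: subset_trans IH.
rewrite [X in _ `<=` X](closure_id _).1; last exact: closed_closure.
exact/closure_subset/supp_derive.
Qed.

Lemma test_pderiv s phi : test_function Om phi -> test_function Om (pderiv s phi).
Proof.
move=> [sp cp pO]; split; first exact: smooth_pderiv.
- by apply: subclosed_compact cp _; [exact: closed_closure|exact: supp_pderiv].
- by apply: subset_trans pO; exact: supp_pderiv.
Qed.

Lemma test_support phi : test_function Om phi -> exists r, support_in_cube phi r.
Proof. by move=> [_ cp _]; exact: compact_support_in_cube. Qed.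

Lemma test_continuous phi : test_function Om phi -> continuous phi.
Proof. by move=> [sp _ _]; exact: (sp [::]).1. Qed.

Lemma test_sqint phi : test_function Om phi -> sqint mu phi.
Proof.
by move=> tp; have [r pr] := test_support tp;
  apply: (continuous_sqint (test_continuous tp) pr).
Qed.

Lemma pderiv_lin (a b : R) phi psi s : smooth phi -> smooth psi ->
  pderiv s (fun x => a * phi x + b * psi x) =
  fun x => a * pderiv s phi x + b * pderiv s psi x.
Proof.
move=> sp sq; elim: s => //= i s IH; rewrite -/(pderiv s _) IH.
apply/funext => x.
have dp := (sp s).2 i x; have dq := (sq s).2 i x.
have := deriveD (derivableZ (k := a) dp) (derivableZ (k := b) dq).
by rewrite (deriveZ a dp) (deriveZ b dq).
Qed.

Lemma smooth_lin (a b : R) phi psi : smooth phi -> smooth psi ->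
  smooth (fun x => a * phi x + b * psi x).
Proof.
move=> sp sq s; rewrite pderiv_lin//; split => [x|i x].
  have cp : pderiv s phi @ x --> pderiv s phi x := (sp s).1 x.
  have cq : pderiv s psi @ x --> pderiv s psi x := (sq s).1 x.
  exact: (cvgD (cvgMl_tmp (a := a) cp) (cvgMl_tmp (a := b) cq)).
exact: (derivableD (derivableZ (k := a) ((sp s).2 i x)) (derivableZ (k := b) ((sq s).2 i x))).
Qed.

Lemma test_lin (a b : R) phi psi : test_function Om phi -> test_function Om psi ->
  test_function Om (fun x => a * phi x + b * psi x).
Proof.
move=> [sp cp pO] [sq cq qO].
have sub : supp (fun x => a * phi x + b * psi x) `<=` supp phi `|` supp psi.
  rewrite /supp -closureU; apply: closure_subset => x /= h.
  have [p0|] := eqVneq (phi x) 0; last by left.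
  by right; apply: contra_neq h => q0; rewrite p0 q0 !mulr0 addr0.
split; first exact: smooth_lin.
- by apply: (subclosed_compact _ _ sub); [exact: closed_closure|exact: compactU].
- by apply: subset_trans sub _ => x [/pO|/qO].
Qed.

(** The product rule for phi psi: its derivative integrates to zero over R^N, and the integral over
    the domain is the same because phi is supported there. *)
Lemma inner_derive i phi psi : test_function Om phi -> test_function Om psi ->
  ip mu (pderiv [:: i] phi) psi = - ip mu phi (pderiv [:: i] psi).
Proof.
move=> tp tq.
have [sp cp pO] := tp; have [sq cq qO] := tq.
have [r pr] := test_support tp.
have cphi := (sp [::]).1; have cpsi := (sq [::]).1.
have cdphi := (sp [:: i]).1; have cdpsi := (sq [:: i]).1.
have dphi x := (sp [::]).2 i x; have dpsi x := (sq [::]).2 i x.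
pose h x := phi x * psi x.
have hE : 'D_(e i) h = (fun x => pderiv [:: i] phi x * psi x + phi x * pderiv [:: i] psi x).
  apply/funext => x; have := deriveM (dphi x) (dpsi x).
  by move=> /= ->; rewrite addrC; congr (_ + _); exact: mulrC.
have ch : continuous h by move=> x; exact: (cvgM (cphi x) (cpsi x)).
have ch' : continuous ('D_(e i) h).
  rewrite hE => x.
  exact: (cvgD (cvgM (cdphi x) (cpsi x)) (cvgM (cphi x) (cdpsi x))).
have dh x : derivable h x (e i) by exact: (derivableM (dphi x) (dpsi x)).
have hr : support_in_cube h r.
  by move=> x hx; apply: pr; apply: contra_neq hx => px; rewrite /h px mul0r.
have h'r := derive_support_in_cube (e := e i) hr.
have := integral_partial_eq0 ch ch' dh hr.
have [M hM] := continuous_support_bounded ch' h'r.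
rewrite -(integral_mu_dom _ h'r hM); last 2 first.
- exact: continuous_measurable_rV.
- move=> x /supp_derive hx; apply: pO; apply: closure_subset hx => y /=.
  by apply: contra_neq => py; rewrite /h py mul0r.
have st := test_sqint tp; have su := test_sqint tq.
have sdp := test_sqint (test_pderiv [:: i] tp); have sdq := test_sqint (test_pderiv [:: i] tq).
move=> H; apply/eqP; rewrite -addr_eq0; apply/eqP.
rewrite /ip -RintegralD//; [|exact: sqint_mul|exact: sqint_mul].
rewrite (_ : Rintegral _ _ _ = \int[mu]_x ('D_(e i) h x)); last by rewrite hE.
by rewrite /Rintegral H.
Qed.

End test_functions.

(** * Smooth bump functions *)

Section smooth_real_functions.
Context {R : realType}.
Implicit Types (f g : R -> R) (n : nat).

Fixpoint Cn n f : Prop :=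
  if n is m.+1 then (forall x : R, derivable f x 1) /\ Cn m (derive1 f) else True.

Lemma CnW n f : Cn n.+1 f -> Cn n f.
Proof.
elim: n f => //= n IH f [df Cf]; split => //.
by apply: IH; case: Cf.
Qed.

Lemma Cn_lin n (a b : R) f g : Cn n f -> Cn n g -> Cn n (fun t => a * f t + b * g t).
Proof.
elim: n f g => //= n IH f g [df Cf] [dg Cg]; split.
  by move=> x; exact: (derivableD (derivableZ (k := a) (df x)) (derivableZ (k := b) (dg x))).
rewrite (_ : derive1 _ = fun t => a * derive1 f t + b * derive1 g t); first exact: IH.
apply/funext => x; rewrite !derive1E.
have := deriveD (derivableZ (k := a) (df x)) (derivableZ (k := b) (dg x)).
by rewrite (deriveZ a (df x)) (deriveZ b (dg x)).
Qed.

Lemma CnM n f g : Cn n f -> Cn n g -> Cn n (fun t => f t * g t).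
Proof.
elim: n f g => //= n IH f g [df Cf] [dg Cg]; split.
  by move=> x; exact: (derivableM (df x) (dg x)).
rewrite (_ : derive1 _ = fun t => 1 * (f t * derive1 g t) + 1 * (derive1 f t * g t)).
  by apply: Cn_lin; apply: IH => //; apply: CnW; split.
apply/funext => x; rewrite !derive1E.
have -> := deriveM (df x) (dg x).
by rewrite !mul1r; congr (_ + _); exact: mulrC.
Qed.

Lemma Cn_affine n (c d : R) f : Cn n f -> Cn n (fun t => f (c * t + d)).
Proof.
elim: n f => //= n IH f [df Cf].
have H (x : R) : is_derive x 1 (fun t : R => f (c * t + d)) (derive1 f (c * x + d) * c).
  have h : is_derive x 1 (fun t : R => c * t + d) c.
    have := is_deriveD (is_deriveZ c (is_derive_id x 1)) (is_derive_cst d x 1).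
    by rewrite addr0 [_ *: _]mulr1.
  apply: (is_derive1_comp (f := f) (g := fun t : R => c * t + d)).
  by rewrite derive1E; exact: derivableP.
split; first by move=> x; have [] := H x.
rewrite (_ : derive1 _ = fun t => c * derive1 f (c * t + d) + 0 * derive1 f (c * t + d)).
  by apply: Cn_lin; exact: IH.
by apply/funext => x; rewrite derive1E; have [_ ->] := H x; rewrite mul0r addr0 mulrC.
Qed.

(* These functions span the derivatives of exp(-1/t), and [flat 0 (k * t)] tends
   to the indicator of t > 0, whence bumps that tend to indicators of boxes. *)
Definition flat n (t : R) : R := if 0 < t then t^-1 ^+ n * expR (- t^-1) else 0.

(** The Taylor bound x^(n+1) / (n+1)! <= exp x at x = 1/t. Taken one index higher, it makes the
    difference quotients of [flat n] at 0 tend to 0. *)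
Lemma flat_bound n t : 0 <= flat n t <= n.+1`!%:R * `|t|.
Proof.
rewrite /flat; case: ifPn => [t0|_]; last by rewrite lexx mulr_ge0.
have tV0 : 0 <= t^-1 by rewrite invr_ge0 ltW.
rewrite gtr0_norm//; apply/andP; split; first by rewrite mulr_ge0 ?expR_ge0 ?exprn_ge0.
have H : t^-1 ^+ n.+1 <= n.+1`!%:R * expR t^-1.
  rewrite mulrC -ler_pdivrMr ?ltr0n ?fact_gt0//.
  by apply: le_trans (expR_ge1Dxn n tV0); rewrite lerDr.
rewrite expRN ler_pdivrMr ?expR_gt0// mulrAC -ler_pdivrMr//.
by rewrite -exprSr.
Qed.

(** Differentiation maps the family [flat] into its own span, so a single induction gives all
    orders; the factor 1 matches the shape of [Cn_lin]. *)
Lemma derive_flat n (t : R) :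
  is_derive t 1 (flat n) (1 * flat n.+2 t + (- n%:R) * flat n.+1 t).
Proof.
have [t0|t0|->] := ltgtP t 0.
- rewrite {2 3}/flat ltNge (ltW t0)/= !mulr0 addr0.
  apply: (@near_eq_is_derive _ _ _ (cst 0 : R -> R)).
  near=> s; rewrite /flat ltNge (_ : s <= 0)//.
  by apply/ltW; near: s; exact: lt_nbhsl.
- apply: (@near_eq_is_derive _ _ _ (fun t : R => t^-1 ^+ n * expR (- t^-1))).
    near=> s; rewrite /flat (_ : 0 < s)//.
    by near: s; exact: lt_nbhsr.
  have tn0 : t != 0 by rewrite gt_eqF.
  have dV : is_derive t 1 (fun s : R => s^-1) (- t ^- 2).
    have := deriveV tn0 (@derivable_id _ _ t 1) ; rewrite derive_id => h.
    apply: DeriveDef; first exact: derivableV.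
    by rewrite h [_ *: _]mulr1.
  have dE : is_derive t 1 (fun s : R => expR (- s^-1)) (expR (- t^-1) * t ^- 2).
    apply: (is_derive1_comp (f := expR) (g := fun s : R => - s^-1)).
    by have := is_deriveN dV; rewrite opprK.
  have := is_deriveM (is_deriveX n dV) dE.
  rewrite /flat t0 /=.
  rewrite (_ : (_ + _)%R = 1 * (t^-1 ^+ n.+2 * expR (- t^-1)) +
      - n%:R * (t^-1 ^+ n.+1 * expR (- t^-1))); last first.
    set E := expR _; have -> : ((fun s : R => s^-1) ^+ n) t = t^-1 ^+ n by rewrite fctE.
    rewrite -!exprVn; move: E (t^-1) => E x.
    rewrite /GRing.scale /=; case: n => [|n] /=; rewrite ?exprS.
      by ring.
    by move: (n.+1%:R : R) (x ^+ n) => m y; ring.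
  suff -> : (fun t => t^-1 ^+ n * expR (- t^-1)) =
      (fun s : R => s^-1) ^+ n * (fun s : R => expR (- s^-1)) by [].
  by apply/funext => s; rewrite [RHS]/GRing.mul/= fctE.
- rewrite {2 3}/flat ltxx !mulr0 addr0.
  (* At 0 the quotient is [flat n.+1 h] for h > 0 and zero for h < 0. *)
  have Q0 : (fun h : R => h^-1 *: ((flat n \o shift 0) (h *: 1) - flat n 0)) @ 0^' --> 0.
    apply/norm_cvg0P.
    apply: (@squeeze_cvgr _ _ _ _ (cst 0) (fun h : R => n.+2`!%:R * `|h|)).
    + apply: nearW => h /=; rewrite normr_ge0/= addr0 [h *: 1]mulr1 {2}/flat ltxx subr0.
      have [h0|h0] := ltP 0 h; last first.
        by rewrite /flat ltNge h0/= [_ *: _]mulr0 normr0 mulr_ge0.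
      have -> : h^-1 *: flat n h = flat n.+1 h by rewrite /flat h0 exprS -mulrA.
      by have /andP[f0 fh] := flat_bound n.+1 h; rewrite (ger0_norm f0).
    + exact: cvg_cst.
    + apply: (cvg_trans (cvg_app _ (cvg_within _))).
      rewrite -[X in _ --> X](mulr0 n.+2`!%:R) -[X in _ * X](@normr0 _ R).
      by apply: cvgMl_tmp; apply: cvg_norm; exact: cvg_id.
  apply: DeriveDef; first by apply/cvg_ex; exists 0.
  exact: cvg_lim Q0.
Unshelve. all: by end_near.
Qed.

Lemma Cn_flat m n : Cn m (flat n).
Proof.
elim: m n => //= m IH n; split; first by move=> x; have [] := derive_flat n x.
rewrite (_ : derive1 _ = fun t => 1 * flat n.+2 t + (- n%:R) * flat n.+1 t).
  exact: Cn_lin.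
by apply/funext => x; rewrite derive1E; have [_ ->] := derive_flat n x.
Qed.

Definition bump1 (k : nat) (a b t : R) : R :=
  flat 0 (k.+1%:R * (t - a)) * flat 0 (k.+1%:R * (b - t)).

Lemma Cn_bump1 n k a b : Cn n (bump1 k a b).
Proof.
apply: CnM.
  rewrite (_ : (fun t => _) = fun t => flat 0 (k.+1%:R * t + - (k.+1%:R * a))).
    exact/Cn_affine/Cn_flat.
  by apply/funext => t; rewrite mulrBr.
rewrite (_ : (fun t => _) = fun t => flat 0 (- k.+1%:R * t + k.+1%:R * b)).
  exact/Cn_affine/Cn_flat.
by apply/funext => t; congr flat; ring.
Qed.

Lemma flat0_itv t : 0 <= flat 0 t <= 1.
Proof.
rewrite /flat; case: ifPn => [t0|_]; last by rewrite lexx ler01.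
by rewrite expr0 mul1r expR_ge0/= -expR0 ler_expR oppr_le0 invr_ge0 ltW.
Qed.

Lemma bump1_itv k a b t : 0 <= bump1 k a b t <= 1.
Proof.
have /andP[p0 p1] := flat0_itv (k.+1%:R * (t - a)).
have /andP[q0 q1] := flat0_itv (k.+1%:R * (b - t)).
by rewrite mulr_ge0//= mulr_ile1.
Qed.

Lemma flat0_cvg t : flat 0 (k.+1%:R * t) @[k --> \oo] --> ((0 < t)%R%:R : R).
Proof.
have [t0|t0] := ltP 0 t; last first.
  rewrite (_ : (fun k => _) = cst 0); first exact: cvg_cst.
  apply/funext => k; rewrite /flat ifF//.
  by apply/negbTE; rewrite -leNgt mulr_ge0_le0.
rewrite (_ : (fun k => _) = fun k => expR (- (k.+1%:R^-1 * t^-1))); last first.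
  by apply/funext => k; rewrite /flat mulr_gt0// expr0 mul1r invfM.
rewrite -[X in _ --> X]/(1 : R) -[X in _ --> X]expR0.
have h : - (k.+1%:R^-1 * t^-1) @[k --> \oo] --> (0 : R).
  rewrite -oppr0; apply: cvgN; rewrite -(mul0r t^-1); apply: cvgMr_tmp.
  exact: cvg_harmonic.
by apply: (cvg_comp _ _ h); exact: continuous_expR.
Qed.

Lemma bump1_cvg a b t :
  bump1 k a b t @[k --> \oo] --> ((a < t < b)%R%:R : R).
Proof.
rewrite (_ : (a < t < b)%R%:R = (0 < t - a)%R%:R * (0 < b - t)%R%:R); last first.
  by rewrite !subr_gt0 -natrM mulnb.
by apply: cvgM; exact: flat0_cvg.
Qed.

Lemma bump1_eq0 k a b t : ~~ (a < t < b) -> bump1 k a b t = 0.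
Proof.
rewrite negb_and -!leNgt => /orP[ta|bt]; rewrite /bump1 /flat.
  by rewrite [in X in X * _]ifF ?mul0r//; apply/negbTE; rewrite -leNgt mulr_ge0_le0// subr_le0.
by rewrite [in X in _ * X]ifF ?mulr0//; apply/negbTE; rewrite -leNgt mulr_ge0_le0// subr_le0.
Qed.

End smooth_real_functions.

(** * Products of functions of one variable *)

Section product_functions.
Context {R : realType} {N : nat}.
Implicit Types (g : 'I_N -> R -> R) (x : 'rV[R]_N) (s : seq 'I_N).
Local Notation e i := (delta_mx ord0 i : 'rV[R]_N).

Definition prodf g x : R := \prod_i g i (x ord0 i).

Definition smooth1 (f : R -> R) := forall n, Cn n f.

Lemma smooth1_derivable f (x : R) : smooth1 f -> derivable f x 1.
Proof. by move=> /(_ 1%N) []. Qed.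

Lemma smooth1_derive f : smooth1 f -> smooth1 (derive1 f).
Proof. by move=> sf n; have [] := sf n.+1. Qed.

Lemma smooth1_continuous f : smooth1 f -> continuous f.
Proof.
by move=> sf x; apply/differentiable_continuous/derivable1_diffP/smooth1_derivable.
Qed.

Lemma prodf_line g x j t : prodf g (x + t *: e j) =
  (\prod_(i | i != j) g i (x ord0 i)) * g j (x ord0 j + t * 1).
Proof.
rewrite /prodf (bigD1 j)//= mulrC; congr (_ * _).
  by apply: eq_bigr => i ij; rewrite addZdeltaE (negbTE ij) mulr0 addr0.
by rewrite addZdeltaE eqxx.
Qed.

Definition derive_at j g i := if i == j then derive1 (g i) else g i.

Lemma is_derive_prodf g x j : (forall i, smooth1 (g i)) ->
  is_derive x (e j) (prodf g) (prodf (derive_at j g) x).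
Proof.
move=> sg; pose C := \prod_(i | i != j) g i (x ord0 i).
have dg : derivable (g j) (x ord0 j) 1 by exact: smooth1_derivable.
have gl (t : R) : prodf g (x + t *: e j) = C * g j (x ord0 j + t *: (1 : R)).
  exact: prodf_line.
apply: DeriveDef.
  exact: (derivable_line gl (derivableZ (k := C) dg)).
apply: etrans (derive_line (h := C *: g j) gl) _.
rewrite (deriveZ C dg) -derive1E.
rewrite /prodf (bigD1 j)//= /derive_at eqxx [RHS]mulrC; congr (_ * _).
by apply: eq_bigr => i ij; rewrite (negbTE ij).
Qed.

(** Only the multiplicities [count_mem i s] enter, so the order of differentiation is immaterial on
    products; this is what bumps of product form are chosen for. *)
Lemma pderiv_prodf s g : (forall i, smooth1 (g i)) ->
  pderiv s (prodf g) = prodf (fun i => iter (count_mem i s) (@derive1 _ R) (g i)).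
Proof.
move=> sg; elim: s => [|j s IH] //=.
have sg' i n : smooth1 (iter n (@derive1 _ R) (g i)).
  by elim: n => //= n; exact: smooth1_derive.
rewrite -/(pderiv s _) IH; apply/funext => x.
have [_ ->] := is_derive_prodf x j (fun i => sg' i (count_mem i s)).
by apply: eq_bigr => i _; rewrite /derive_at eq_sym; case: (j == i).
Qed.

Lemma smooth_prodf g : (forall i, smooth1 (g i)) -> smooth (prodf g).
Proof.
move=> sg s; rewrite pderiv_prodf//.
have sg' i : smooth1 (iter (count_mem i s) (@derive1 _ R) (g i)).
  by elim: (count_mem i s) => //= n; exact: smooth1_derive.
split; last by move=> i x; have [] := is_derive_prodf x i sg'.
apply: continuous_big; first exact: mul_continuous.
move=> i _ x; apply: continuous_comp; first exact: coord_continuous.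
exact: smooth1_continuous.
Qed.

Definition obox (a b : 'rV[R]_N) : set 'rV[R]_N :=
  [set x | forall i, a ord0 i < x ord0 i < b ord0 i].

Definition cbox (a b : 'rV[R]_N) : set 'rV[R]_N :=
  [set x | forall i, a ord0 i <= x ord0 i <= b ord0 i].

Definition box_bump k (a b : 'rV[R]_N) := prodf (fun i => bump1 k (a ord0 i) (b ord0 i)).

Lemma compact_cbox a b : compact (cbox a b).
Proof.
rewrite (_ : cbox a b =
    [set x : 'rV[R]_N | forall i, `[a ord0 i, b ord0 i]%classic (x ord0 i)]).
  by apply: (@rV_compact R N (fun i => `[a ord0 i, b ord0 i]%classic)) => i; exact: segment_compact.
by apply/seteqP; split => x /= H i; have := H i; rewrite in_itv/=.
Qed.

Lemma box_bump_eq0 k a b x : ~ obox a b x -> box_bump k a b x = 0.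
Proof.
move=> /existsNP[i /negP xi].
by rewrite /box_bump /prodf (bigD1 i)//= bump1_eq0// mul0r.
Qed.

Lemma supp_box_bump k a b : supp (box_bump k a b) `<=` cbox a b.
Proof.
have cb : closed (cbox a b) by apply: compact_closed; [exact: norm_hausdorff|exact: compact_cbox].
rewrite [X in _ `<=` X](closure_id _).1//; apply: closure_subset => x /= bx i.
have [/(_ i)/andP[/ltW -> /ltW ->]//|/(box_bump_eq0 k) b0] := pselect (obox a b x).
by rewrite b0 eqxx in bx.
Qed.

Lemma smooth_box_bump k a b : smooth (box_bump k a b).
Proof. by apply: smooth_prodf => i n; exact: Cn_bump1. Qed.

Lemma pderiv_box_bumpC k a b i j :
  pderiv [:: i; j] (box_bump k a b) = pderiv [:: j; i] (box_bump k a b).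
Proof.
rewrite !pderiv_prodf; try by move=> ? ?; exact: Cn_bump1.
by apply/funext => x; apply: eq_bigr => l _; rewrite /= !addn0 addnC.
Qed.

Lemma box_bump_itv k a b x : 0 <= box_bump k a b x <= 1.
Proof.
by apply/andP; split; [apply: prodr_ge0|apply: prodr_ile1] => i _;
  have /andP[] := bump1_itv k (a ord0 i) (b ord0 i) (x ord0 i) => // -> ->.
Qed.

Lemma box_bump_cvg a b x : box_bump k a b x @[k --> \oo] --> (\1_(obox a b) x : R).
Proof.
rewrite (_ : \1_(obox a b) x = \prod_i (a ord0 i < x ord0 i < b ord0 i)%R%:R).
  apply: cvg_big; first exact: mul_continuous.
  by move=> i _; exact: bump1_cvg.
rewrite indicE; have [H|/existsNP[i /negP xi]] := pselect (obox a b x).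
  by rewrite mem_set// big1// => i _; rewrite H.
rewrite memNset; first by rewrite (bigD1 i)//= (negbTE xi) mul0r.
by move=> /(_ i); exact/negP.
Qed.

Lemma test_box_bump (Om : domain R N) k a b : cbox a b `<=` domain_set Om ->
  test_function Om (box_bump k a b).
Proof.
move=> abO; split; first exact: smooth_box_bump.
- apply: subclosed_compact (@compact_cbox a b) (@supp_box_bump k a b); exact: closed_closure.
- by apply: subset_trans abO; exact: supp_box_bump.
Qed.

End product_functions.

(** * The fundamental lemma of the calculus of variations *)

Section fundamental_lemma.
Context {R : realType} {N : nat} (Om : domain R N).
Implicit Types (a b : 'rV[R]_N) (f : 'rV[R]_N -> R).
Local Notation mu := (mu_dom Om).

Lemma measurable_obox a b : measurable (obox a b).
Proof.
rewrite (_ : obox a b = \bigcap_(i in [set: 'I_N])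
   ((fun x : 'rV[R]_N => x ord0 i) @^-1` `]a ord0 i, b ord0 i[%classic)).
  apply: fin_bigcap_measurable => // i _; rewrite -[X in measurable X]setTI.
  exact: measurable_rV_coord.
by apply/seteqP; split => x /= H i => [_|]; have := H i; rewrite /= in_itv/=; [|apply].
Qed.

Lemma sqint_obox a b : sqint mu (\1_(obox a b)).
Proof.
have mab := measurable_obox a b.
split; first exact: measurable_indic.
have [r abr] : exists r, support_in_cube (\1_(obox a b) : 'rV[R]_N -> R) r.
  apply: compact_support_in_cube; apply: subclosed_compact (@compact_cbox _ _ a b) _.
    exact: closed_closure.
  rewrite [X in _ `<=` X](closure_id _).1; last first.
    by apply: compact_closed; [exact: norm_hausdorff|exact: compact_cbox].
  apply: closure_subset => x /=; rewrite indicE.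
  have [/set_mem xab _ i|_] := boolP (x \in obox a b); last by rewrite eqxx.
  by have /andP[/ltW -> /ltW ->] := xab i.
apply: (@integrable_support_in_cube _ _ _ _ r 1).
- by apply: measurable_funX; exact: measurable_indic.
- by move=> x; rewrite sqrf_eq0; exact: abr.
- by move=> x; rewrite indicE; case: (_ \in _); rewrite ?expr1n ?expr0n ?normr1 ?normr0.
- exact: mrestr_cube.
Qed.

Lemma sqint_norm f : sqint mu f -> sqint mu (fun x => `|f x|).
Proof.
move=> [mf if2]; split; first exact: measurableT_comp.
by under eq_fun do rewrite real_normK ?num_real//.
Qed.

(** Dominated convergence: the bumps lie between 0 and 1 and tend to the indicator of the box. The
    majorant |f| times this indicator is integrable as a product of two square-integrable
    functions. *)
Lemma integral_obox_eq0 f a b : sqint mu f ->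
  (forall k, ip mu f (box_bump k a b) = 0) -> cbox a b `<=` domain_set Om ->
  (\int[mu]_(x in obox a b) (f x)%:E = 0)%E.
Proof.
move=> sf f0 abO; have [mf _] := sf; have mab := measurable_obox a b.
have sb k : sqint mu (box_bump k a b) by apply: test_sqint; exact: test_box_bump.
rewrite integral_mkcond.
have h := @dominated_convergence _ _ _ mu setT measurableT
  (fun k x => (f x * box_bump k a b x)%:E) ((EFin \o f) \_ (obox a b))
  (EFin \o (fun x => `|f x| * \1_(obox a b) x)).
have fE x : ((EFin \o f) \_ (obox a b)) x = (f x * \1_(obox a b) x)%:E.
  by rewrite patchE indicE; case: ifPn => _; rewrite ?mulr1 ?mulr0.
have {h}[] := h.
- by move=> k; apply/measurable_EFinP; apply: measurable_funM => //; case: (sb k).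
- by rewrite -measurable_restrict// setTI; apply: measurable_funTS; exact/measurable_EFinP.
- apply: nearW => x _; rewrite fE; apply: cvg_EFin; first exact: nearW.
  rewrite (_ : fine \o _ = fun k => f x * box_bump k a b x)//.
  by apply: cvgMl_tmp; exact: box_bump_cvg.
- by apply: sqint_mul; [exact: sqint_norm|exact: sqint_obox].
- apply: nearW => x k _; rewrite lee_fin normrM ler_wpM2l//.
  rewrite indicE; have [xab|xab] := pselect (obox a b x).
    by rewrite mem_set//; have /andP[b0 b1] := box_bump_itv k a b x; rewrite ger0_norm.
  by rewrite box_bump_eq0// normr0.
move=> _ _ h.
apply: (cvg_unique _ h); first exact: ereal_hausdorff.
rewrite (_ : [sequence _]_n = cst 0%E); first exact: cvg_cst.
apply/funext => k /=; rewrite -[RHS]/(0%R%:E) -(f0 k) /ip /Rintegral fineK//.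
exact: (integrable_fin_num measurableT (sqint_mul sf (sb k))).
Qed.

Lemma sqint_obox_integrable f a b : sqint mu f ->
  mu.-integrable setT (EFin \o (f \_ (obox a b))).
Proof.
move=> sf; have := sqint_mul sf (sqint_obox a b).
congr (mu.-integrable setT (EFin \o _)); apply/funext => x.
by rewrite patchE indicE; case: ifPn => _; rewrite ?mulr1 ?mulr0.
Qed.

Let boxes : set (set 'rV[R]_N) := [set A | exists a b, A = obox a b].

(** The inclusion of closed boxes keeps the intersection inside the domain, so that bumps on it are
    again test functions. *)
Lemma oboxI a b c d : exists u v,
  obox a b `&` obox c d = obox u v /\ cbox u v `<=` cbox a b.
Proof.
exists (\row_i Num.max (a ord0 i) (c ord0 i)), (\row_i Num.min (b ord0 i) (d ord0 i)).
split.
  apply/seteqP; split => x /=.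
    move=> [H1 H2] i; rewrite !mxE gt_max lt_min.
    by have /andP[-> ->] := H1 i; have /andP[-> ->] := H2 i.
  move=> H; split => i; have := H i; rewrite !mxE gt_max lt_min.
    by move=> /andP[/andP[-> _] /andP[-> _]].
  by move=> /andP[/andP[_ ->] /andP[_ ->]].
move=> x H i; have := H i; rewrite !mxE ge_max le_min.
by move=> /andP[/andP[-> _] /andP[-> _]].
Qed.

Lemma setI_closed_obox : setI_closed boxes.
Proof.
move=> _ _ [a [b ->]] [c [d ->]].
by have [u [v [-> _]]] := oboxI a b c d; exists u, v.
Qed.

(** Every open set is a countable union of rational boxes, and these are open boxes. *)
Lemma borel_obox : @measurable _ 'rV[R]_N = <<s boxes >>.
Proof.
apply/seteqP; split; last first.
  apply: smallest_sub; first exact: sigma_algebra_measurable.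
  by move=> _ [a [b ->]]; exact: measurable_obox.
apply: smallest_sub; first exact: smallest_sigma_algebra.
move=> A oA; rewrite (open_bigcup_rat_box oA) bigcup_mkcond.
(* Turns the union over the countable type of rational boxes into a union over nat, with the empty
   set at codes of no box. *)
have -> : forall F : 'rV[rat]_N * rat -> set 'rV[R]_N, \bigcup_c F c =
    \bigcup_n (if unpickle n is Some c then F c else set0).
  move=> F; apply/seteqP; split => x [i _ Fx].
    by exists (pickle i) => //; rewrite pickleK.
  by move: Fx; case: (unpickle i) => // c Fx; exists c.
have sB := smallest_sigma_algebra setT boxes.
apply: (sigma_algebra_bigcup (D := setT)) => n; case: (unpickle n) => [c|]; last exact: sigma_algebra0.
case: ifPn => _; last exact: sigma_algebra0.
apply: sub_sigma_algebra.
exists (\row_i (ratr (c.1 ord0 i) - ratr c.2)), (\row_i (ratr (c.1 ord0 i) + ratr c.2)).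
by apply/seteqP; split => x /= H i; have := H i; rewrite !mxE ltr_distl.
Qed.

(** The sets over which f, cut to the box, integrates to zero form a Dynkin class containing all
    open boxes, hence every measurable set. The cut makes f integrable and keeps all intersections
    inside the domain. *)
Lemma obox_ae_eq0 f a b : sqint mu f ->
  (forall k c d, cbox c d `<=` domain_set Om -> ip mu f (box_bump k c d) = 0) ->
  cbox a b `<=` domain_set Om -> ae_eq mu setT (f \_ (obox a b)) (cst 0).
Proof.
move=> sf f0 abO.
have iF := sqint_obox_integrable a b sf.
have : ae_eq mu setT (EFin \o (f \_ (obox a b))) (cst 0%E).
  apply: integral_ae_eq => //.
  move=> E _; rewrite borel_obox integral0.
  apply: (@dynkin_induction _ _ _
    (fun E => \int[mu]_(x in E) (EFin \o (f \_ (obox a b))) x = 0)%E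
    borel_obox setI_closed_obox).
  - have <- := integral_obox_eq0 sf (fun k => f0 k a b abO) abO.
    by rewrite [RHS]integral_mkcond restrict_EFin.
  - move=> _ [c [d ->]].
    have [u [v [uv uvab]]] := oboxI a b c d.
    have uvO := subset_trans uvab abO.
    by rewrite -restrict_EFin -integral_mkcondr setIC uv;
      apply: (integral_obox_eq0 sf _ uvO) => k; exact: f0.
  - move=> S mS S0.
    have := integral_obox_eq0 sf (fun k => f0 k a b abO) abO.
    rewrite integral_mkcond restrict_EFin -(setUv S) integral_setU_EFin//.
    + by rewrite S0 add0e.
    + exact: measurableC.
    + by rewrite setUv; have /integrableP[/measurable_EFinP] := iF.
    + by apply/disj_setPS; rewrite setICr.
  - move=> F mF tF F0; rewrite integral_bigcup//; first exact: eseries0.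
    by apply: integrableS iF => //; exact: bigcupT_measurable.
by apply: filterS => x /(_ I) /= [->].
Qed.

Lemma rat_cbox_cover (x : 'rV[R]_N) : domain_set Om x ->
  exists c : 'rV[rat]_N * 'rV[rat]_N,
    obox (map_mx ratr c.1) (map_mx ratr c.2) x /\
    cbox (map_mx ratr c.1) (map_mx ratr c.2) `<=` domain_set Om.
Proof.
move=> Ox; have /nbhs_ballP[e /= e0 eO] : nbhs x (domain_set Om).
  by apply: open_nbhs_nbhs; split => //; exact: domain_open.
have /choice[p pP] : forall i, exists q : rat * rat,
    x ord0 i - e < ratr q.1 < x ord0 i /\ x ord0 i < ratr q.2 < x ord0 i + e.
  move=> i.
  have /rat_in_itvoo[q1 h1] : x ord0 i - e < x ord0 i by rewrite gtrBl.
  have /rat_in_itvoo[q2 h2] : x ord0 i < x ord0 i + e by rewrite ltrDl.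
  by exists (q1, q2); rewrite in_itv in h1; rewrite in_itv in h2.
exists (\row_i (p i).1, \row_i (p i).2) => /=; split.
  by move=> i; rewrite !mxE; have [/andP[_ ->] /andP[-> _]] := pP i.
move=> y yp; apply: eO; split => // i j; rewrite [i]ord1.
have [/andP[h1 _] /andP[_ h2]] := pP j; have := yp j; rewrite !mxE => /andP[h3 h4].
rewrite /ball/= distrC ltr_distl.
by rewrite (lt_le_trans h1 h3) (le_lt_trans h4 h2).
Qed.

(** Countably many rational boxes with closure in the domain cover it, so the exceptional sets add
    up to a null set. The hypothesis is restricted to box bumps because these are the functions
    whose mixed derivatives are known to commute. *)
Lemma du_bois_reymond f : sqint mu f ->
  (forall k c d, cbox c d `<=` domain_set Om -> ip mu f (box_bump k c d) = 0) ->
  ae_eq mu setT f (cst 0).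
Proof.
move=> sf f0.
pose P n x := if unpickle n is Some c then
  let a := map_mx ratr (c.1 : 'rV[rat]_N) in let b := map_mx ratr (c.2 : 'rV[rat]_N) in
  cbox a b `<=` domain_set Om -> (f \_ (obox a b)) x = 0 else True.
have aeP : {ae mu, forall x, forall n, P n x}.
  apply/ae_foralln => n; rewrite /P; case: (unpickle n) => [c|]; last exact: nearW.
  have [H|H] := pselect (cbox (map_mx ratr (c.1 : 'rV[rat]_N))
      (map_mx ratr (c.2 : 'rV[rat]_N)) `<=` domain_set Om).
    by have := obox_ae_eq0 sf f0 H; apply: filterS => x /(_ I) /= + _.
  exact: nearW.
have aeO : {ae mu, forall x, domain_set Om x}.
  exists (~` domain_set Om); split => //.
    exact: measurableC (open_measurable_rV (domain_open Om)).
  by rewrite /= /mrestr setICl measure0.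
apply: filterS2 aeP aeO => x Px Ox _ /=.
have [c [xc cO]] := rat_cbox_cover Ox.
by have := Px (pickle c); rewrite /P pickleK => /(_ cO); rewrite patchE mem_set.
Qed.

End fundamental_lemma.

(** * Identities for test functions *)

Section test_function_identities.
Context {R : realType} {N : nat} (Om : domain R N).
Implicit Types (phi psi f g : 'rV[R]_N -> R) (s : seq 'I_N) (u v : L2 Om).
Local Notation mu := (mu_dom Om).
Local Notation test := (test_function Om).

Lemma ae_eq_of_test f g : sqint mu f -> sqint mu g ->
  (forall phi, test phi -> ip mu f phi = ip mu g phi) -> ae_eq mu setT f g.
Proof.
move=> sf sg fg.
have : ae_eq mu setT (fun x => f x - g x) (cst 0).
  apply: du_bois_reymond; first exact: sqintB.
  move=> k c d cdO; have tb := test_box_bump k cdO.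
  by rewrite ipBl ?fg ?subrr//; exact: test_sqint.
by apply: filterS => x /(_ I) /= /eqP; rewrite subr_eq0 => /eqP.
Qed.

Lemma L2_ext_test u v :
  (forall phi, test phi -> ip mu u phi = ip mu v phi) -> u = v.
Proof. by move=> uv; apply: L2_ext; apply: ae_eq_of_test => //; exact: L2_sqint. Qed.

Lemma test0 : test (fun=> 0).
Proof.
have p0 s : pderiv s (fun=> 0) = (fun=> 0) :> ('rV[R]_N -> R).
  elim: s => //= i s IH; rewrite -/(pderiv s _) IH.
  by apply/funext => x; exact: derive_cst.
have s0 : supp (fun=> 0 : R) = set0 :> set 'rV[R]_N.
  rewrite /supp (_ : [set x | _] = set0) ?closure0//.
  by apply/seteqP; split => // x /=; rewrite eqxx.
split.
- by move=> s; rewrite p0; split=> [|i x]; [exact: cst_continuous|exact: derivable_cst].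
- by rewrite s0; exact: compact0.
- by rewrite s0; exact: sub0set.
Qed.

Lemma testD phi psi : test phi -> test psi -> test (fun x => phi x + psi x).
Proof.
by move=> tp tq; have := test_lin 1 1 tp tq; under eq_fun do rewrite !mul1r.
Qed.

Lemma test_sum (I : Type) (r : seq I) (F : I -> 'rV[R]_N -> R) :
  (forall i, test (F i)) -> test (fun x => \sum_(i <- r) F i x).
Proof.
move=> tF; elim: r => [|i r IH].
  by under eq_fun do rewrite big_nil; exact: test0.
by under eq_fun do rewrite big_cons; exact: testD.
Qed.

Lemma test_laplacian phi : test phi -> test (laplacian phi).
Proof.
move=> tp; apply: (@test_sum _ _ (fun i => pderiv [:: i; i] phi)) => i.
exact: test_pderiv.
Qed.

Lemma laplacian_lin (a b : R) phi psi : test phi -> test psi ->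
  laplacian (fun x => a * phi x + b * psi x) =
  fun x => a * laplacian phi x + b * laplacian psi x.
Proof.
move=> [sp _ _] [sq _ _]; apply/funext => x; rewrite /laplacian !mulr_sumr -big_split.
by apply: eq_bigr => i _; rewrite pderiv_lin.
Qed.

Lemma ip_pderiv2 i j phi psi : test phi -> test psi ->
  ip mu (pderiv [:: i; j] phi) psi = ip mu phi (pderiv [:: j; i] psi).
Proof.
move=> tp tq.
have -> : pderiv [:: i; j] phi = pderiv [:: i] (pderiv [:: j] phi) by [].
rewrite inner_derive//; last exact: test_pderiv.
by rewrite inner_derive ?opprK//; exact: test_pderiv.
Qed.

(* Partial derivatives commute on the product bumps, which detect functions
   that are zero almost everywhere. *)
Lemma pderivC_ae i j phi : test phi ->
  ae_eq mu setT (pderiv [:: i; j] phi) (pderiv [:: j; i] phi).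
Proof.
move=> tp.
have sij := test_sqint (test_pderiv [:: i; j] tp).
have sji := test_sqint (test_pderiv [:: j; i] tp).
have : ae_eq mu setT (fun x => pderiv [:: i; j] phi x - pderiv [:: j; i] phi x) (cst 0).
  apply: du_bois_reymond; first exact: sqintB.
  move=> k c d cdO; have tb := test_box_bump k cdO.
  rewrite (ipBl sij sji (test_sqint tb)); apply/eqP; rewrite subr_eq0; apply/eqP.
  apply: etrans (ip_pderiv2 i j tp tb) (etrans _ (esym (ip_pderiv2 j i tp tb))).
  exact: (congr1 (ip mu phi) (pderiv_box_bumpC k c d j i)).
by apply: filterS => x /(_ I) /= /eqP; rewrite subr_eq0 => /eqP.
Qed.

(** Integration by parts reverses the sequence of directions, whereas [weak_pderiv] keeps it; at
    length two the reversal is undone by [pderivC_ae]. *)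
Lemma ip_pderiv s phi psi : (size s <= 2)%N -> test phi -> test psi ->
  ip mu phi (pderiv s psi) = (- 1) ^+ size s * ip mu (pderiv s phi) psi.
Proof.
move=> + tp tq; case: s => [|i [|j []]]//= _.
- by rewrite expr0 mul1r.
- by rewrite expr1 mulN1r inner_derive// opprK.
- rewrite sqrrN expr1n mul1r; apply: etrans (esym (ip_pderiv2 j i tp tq)) _.
  have mf s := (test_sqint (test_pderiv s tp)).1; have mq := (test_sqint tq).1.
  exact: (ae_eq_ip (mf [:: j; i]) (mf [:: i; j]) mq (pderivC_ae j i tp)).
Qed.

Lemma ip_laplacian phi psi : test phi -> test psi ->
  ip mu phi (laplacian psi) = ip mu (laplacian phi) psi.
Proof.
move=> tp tq; have st s f (tf : test f) := test_sqint (test_pderiv s tf).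
have sp := test_sqint tp; have sq := test_sqint tq.
rewrite ip_sumr//; last by move=> i; exact: st.
rewrite ip_suml//; last by move=> i; exact: st.
by apply: eq_bigr => i _; exact/esym/ip_pderiv2.
Qed.

(** Two integrations by parts. Derivatives are commuted twice: in one factor d_i d_j phi, and then
    in d_j d_i applied to the test function d_j phi. *)
Lemma ip_hessian i j phi : test phi ->
  ip mu (pderiv [:: i; j] phi) (pderiv [:: i; j] phi) =
  ip mu (pderiv [:: i; i] phi) (pderiv [:: j; j] phi).
Proof.
move=> tp; have mp s := (test_sqint (test_pderiv s tp)).1.
have tj := test_pderiv [:: j] tp; have ti := test_pderiv [:: i] tp.
transitivity (ip mu (pderiv [:: i; j] phi) (pderiv [:: j; i] phi)).
  apply: etrans (ipC _ _ _) (etrans _ (ipC _ _ _)).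
  exact: (ae_eq_ip (mp [:: i; j]) (mp [:: j; i]) (mp [:: i; j]) (pderivC_ae i j tp)).
transitivity (- ip mu (pderiv [:: j; i; j] phi) (pderiv [:: i] phi)).
  by apply: oppr_inj; rewrite opprK; exact: (esym (inner_derive j (test_pderiv [:: i; j] tp) ti)).
transitivity (- ip mu (pderiv [:: i; j; j] phi) (pderiv [:: i] phi)).
  apply: (congr1 -%R).
  exact: (ae_eq_ip (mp [:: j; i; j]) (mp [:: i; j; j]) (mp [:: i]) (pderivC_ae j i tj)).
apply: oppr_inj; rewrite opprK.
apply: etrans (inner_derive i (test_pderiv [:: j; j] tp) ti) _.
by apply: (congr1 -%R); exact: ipC.
Qed.

Lemma ip_laplacian_hessian phi : test phi -> ip mu (laplacian phi) (laplacian phi) =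
  \sum_(i < N) \sum_(j < N) ip mu (pderiv [:: i; j] phi) (pderiv [:: i; j] phi).
Proof.
move=> tp; have st s := test_sqint (test_pderiv s tp).
apply: etrans (ip_suml _ (fun i => st [:: i; i]) (test_sqint (test_laplacian tp))) _.
apply: eq_bigr => i _.
apply: etrans (ip_sumr _ (fun j => st [:: j; j]) (st [:: i; i])) _.
by apply: eq_bigr => j _; apply: esym; exact: ip_hessian.
Qed.

Lemma ip_gradient phi : test phi ->
  \sum_(i < N) ip mu (pderiv [:: i] phi) (pderiv [:: i] phi) =
  - ip mu phi (laplacian phi).
Proof.
move=> tp; have st s := test_sqint (test_pderiv s tp).
rewrite [in RHS](ip_sumr _ (fun i => st [:: i; i]) (test_sqint tp)).
rewrite -sumrN; apply: eq_bigr => i _.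
exact: (inner_derive i tp (test_pderiv [:: i] tp)).
Qed.

End test_function_identities.

(** * Closures of the test functions, described by sequences *)

Section sobolev_sequences.
Context {R : realType} {N : nat} (Om : domain R N).
Implicit Types (phi psi f g : 'rV[R]_N -> R) (s : seq 'I_N) (u v : L2 Om).
Local Notation mu := (mu_dom Om).
Local Notation test := (test_function Om).

Lemma L2norm_sqr f : sqint mu f -> L2norm Om f ^+ 2 = ip mu f f.
Proof. by move=> sf; rewrite L2normE// sqr_sqrtr// ip_ge0. Qed.

Lemma L2norm_ge0 f : 0 <= L2norm Om f.
Proof. by rewrite /L2norm fine_ge0// Lnorm_ge0. Qed.

Lemma ip_subC f g : ip mu (fun x => f x - g x) (fun x => f x - g x) =
  ip mu (fun x => g x - f x) (fun x => g x - f x).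
Proof. by apply: eq_Rintegral => x _; ring. Qed.

Lemma cvg2_ae (F : nat -> 'rV[R]_N -> R) f g : (forall n, sqint mu (F n)) ->
  sqint mu f -> sqint mu g -> ae_eq mu setT f g -> cvg2 mu F f -> cvg2 mu F g.
Proof.
move=> sF sf sg fg; rewrite /cvg2.
rewrite (_ : (fun n => ip mu (fun x => F n x - f x) _) =
  fun n => ip mu (fun x => F n x - g x) (fun x => F n x - g x))//.
apply/funext => n.
have mf := (sqintB (sF n) sf).1; have mg := (sqintB (sF n) sg).1.
have ae : ae_eq mu setT (fun x => F n x - f x) (fun x => F n x - g x).
  by apply: filterS fg => x /[apply] /= ->.
exact: ae_eq_ip2.
Qed.

Lemma sobolev0_seq k u : sobolev0 k u ->
  exists D, exists phi : nat -> 'rV[R]_N -> R,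
  [/\ weak_jet k u D, forall n : nat, test (phi n) &
    forall s, (size s <= k)%N -> cvg2 mu (fun n => pderiv s (phi n)) (D s)].
Proof.
move=> [D uD H].
have /choice[phi phiP] : forall n : nat, exists phi,
    test phi /\ sobolev_dist k D phi < n.+1%:R^-1.
  move=> n; have /H[phi tp pn] : 0 < n.+1%:R^-1 :> R by rewrite invr_gt0.
  by exists phi.
exists D, phi; split => // [n|s sk]; first by have [] := phiP n.
have tp n : test (phi n) by have [] := phiP n.
have sd n s' : sqint mu (fun x => D s' x - pderiv s' (phi n) x).
  by apply: sqintB; [exact: L2_sqint|exact: test_sqint (test_pderiv _ _)].
apply: (@squeeze_cvgr _ _ _ _ (cst 0) (fun n : nat => n.+1%:R^-1 : R)).
- apply: nearW => n; rewrite ip_ge0/= ip_subC -L2norm_sqr//.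
  have [_ pn] := phiP n.
  pose F (j : 'I_k.+1) := \sum_(t : j.-tuple 'I_N)
    L2norm Om (fun x => D t x - pderiv t (phi n) x) ^+ 2.
  have F0 j : 0 <= F j by apply: sumr_ge0 => t _; exact: sqr_ge0.
  have le1 : L2norm Om (fun x => D s x - pderiv s (phi n) x) ^+ 2 <= sobolev_dist k D (phi n) ^+ 2.
    rewrite /sobolev_dist -/(\sum_j F j) sqr_sqrtr; last by apply: sumr_ge0 => j _; exact: F0.
    have sk' : (size s < k.+1)%N by [].
    rewrite (bigD1 (Ordinal sk'))//=.
    apply: (@le_trans _ _ (F (Ordinal sk'))); last first.
      by rewrite lerDl; apply: sumr_ge0 => j _; exact: F0.
    rewrite /F /= (bigD1 (in_tuple s))//= lerDl.
    by apply: sumr_ge0 => t _; exact: sqr_ge0.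
  apply: (le_trans le1); apply: (@le_trans _ _ (n.+1%:R^-1 ^+ 2)).
    by rewrite lerXn2r ?nnegrE ?sqrtr_ge0 ?invr_ge0// ltW.
  by rewrite expr2 ler_piMr ?invr_ge0// invf_le1 ?ltr0n// ler1n.
- exact: cvg_cst.
- exact: cvg_harmonic.
Qed.

(** Both sides of the integration by parts formula pass to the limit, so the limits of the
    derivatives are weak derivatives of the limit. The bound k <= 2 is inherited from
    [ip_pderiv]. *)
Lemma sobolev0_lim k u (D : seq 'I_N -> L2 Om) (phi : nat -> 'rV[R]_N -> R) :
  (k <= 2)%N -> u = D [::] -> (forall n, test (phi n)) ->
  (forall s, (size s <= k)%N -> cvg2 mu (fun n => pderiv s (phi n)) (D s)) ->
  sobolev0 k u.
Proof.
move=> k2 uD tp cp.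
have sp s n := test_sqint (test_pderiv s (tp n)).
have sD s := L2_sqint (D s).
exists D.
  move=> s sk psi tq; rewrite uD.
  have sq := test_sqint tq; have sdq := test_sqint (test_pderiv s tq).
  have c1 := cvg2_ip (sp [::]) (sD [::]) (fun=> sdq) sdq (cp [::] isT) (cvg2_cst mu _).
  have c2 := cvg2_ip (sp s) (sD s) (fun=> sq) sq (cp s sk) (cvg2_cst mu _).
  have c3 := cvgMl_tmp (a := (- 1) ^+ size s) c2.
  have E : (fun n => ip mu (pderiv [::] (phi n)) (pderiv s psi)) =
      (fun n => (- 1) ^+ size s * ip mu (pderiv s (phi n)) psi).
    by apply/funext => n; exact: (ip_pderiv (leq_trans sk k2) (tp n) tq).
  rewrite E in c1.
  by apply: (cvg_unique _ c1 (c3 _)); exact: Rhausdorff.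
move=> e e0.
pose F (j : 'I_k.+1) n := \sum_(t : j.-tuple 'I_N)
    L2norm Om (fun x => D t x - pderiv t (phi n) x) ^+ 2.
have F0 : \sum_(j < k.+1) F j n @[n --> \oo] --> (0 : R).
  rewrite [X in _ --> X](_ : 0 = \sum_(j < k.+1) \sum_(t : j.-tuple 'I_N) (0 : R)); last first.
    by rewrite big1// => j _; rewrite big1.
  apply: cvg_big; first exact: add_continuous.
  move=> j _; apply: cvg_big; first exact: add_continuous.
  move=> t _.
  rewrite (_ : (fun n => _) = fun n => ip mu (fun x => pderiv t (phi n) x - D t x)
    (fun x => pderiv t (phi n) x - D t x)).
    by apply: cp; rewrite size_tuple -ltnS.
  apply/funext => n; apply: etrans (L2norm_sqr _) (ip_subC _ _).
  exact: sqintB (sD t) (sp t n).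
have /cvgr0Pnorm_lt/(_ _ (exprn_gt0 2 e0)) [n _ /(_ n (leqnn n)) /= Hn] := F0.
exists (phi n) => //; rewrite /sobolev_dist -/(\sum_j F j n).
rewrite -(ltr_pXn2r (ltn0Sn 1)) ?nnegrE ?sqrtr_ge0 ?ltW//.
rewrite sqr_sqrtr ?(le_lt_trans (ler_norm _) Hn)//.
by apply: sumr_ge0 => j _; apply: sumr_ge0 => t _; exact: sqr_ge0.
Qed.

Lemma sobolev0_test k phi u : (k <= 2)%N -> test phi -> ae_eq mu setT u phi -> sobolev0 k u.
Proof.
move=> k2 tp up.
have /choice[D0 D0P] : forall s, exists v : L2 Om, ae_eq mu setT v (pderiv s phi).
  by move=> s; apply: sqint_L2; exact: test_sqint (test_pderiv s tp).
apply: (@sobolev0_lim k u D0 (fun=> phi)) => //.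
  apply: L2_ext; apply: ae_eq_trans up _; exact: ae_eq_sym (D0P [::]).
move=> s _; have sp := test_sqint (test_pderiv s tp).
apply: (cvg2_ae (fun=> sp) sp (L2_sqint _) (ae_eq_sym (D0P s))).
exact: cvg2_cst.
Qed.

End sobolev_sequences.

(** * The Dirichlet bi-Laplacian *)

Section friedrichs.
Context {R : realType} {N : nat} (Om : domain R N).
Hypothesis hOm : friedrichs_admissible Om.
Implicit Types (phi psi f g : 'rV[R]_N -> R) (s : seq 'I_N) (u v : L2 Om).
Local Notation mu := (mu_dom Om).
Local Notation test := (test_function Om).
Local Notation c := (friedrichs_const Om).

Lemma friedrichs_const_ge0 : 0 <= c.
Proof.
apply: lb_le_inf; first by have [c0 ? ?] := hOm; exists c0.
by move=> x [/ltW].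
Qed.

(** The constant is an infimum, so it has to be shown to be a bound itself. Dividing by the gradient
    norm passes the inequality to the infimum; when that norm is zero, any admissible constant
    already forces u to have norm zero. *)
Lemma friedrichs_const_bound : friedrichs_bound Om c.
Proof.
move=> u G su uG; have [c0 c00 c0b] := hOm.
have g0 : 0 <= gradient_norm G by exact: sqrtr_ge0.
move: g0; rewrite le_eqVlt => /predU1P[g0|g0].
  by have := c0b u G su uG; rewrite -g0 !mulr0.
rewrite -ler_pdivrMr//; apply: lb_le_inf; first by exists c0.
by move=> x [_ xb]; rewrite ler_pdivrMr//; exact: xb.
Qed.

Lemma friedrichs_test phi : test phi ->
  ip mu phi phi <= c ^+ 2 * \sum_(i < N) ip mu (pderiv [:: i] phi) (pderiv [:: i] phi).
Proof.
move=> tp; have sp := test_sqint tp.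
have sdp i := test_sqint (test_pderiv [:: i] tp).
have [u up] := sqint_L2 sp.
have /choice[G GP] : forall i, exists v : L2 Om, ae_eq mu setT v (pderiv [:: i] phi).
  by move=> i; exact: sqint_L2.
have su : sobolev0 1 u by exact: sobolev0_test up.
have uG : weak_gradient u G.
  move=> i psi tq; have sq := test_sqint tq; have sdq := test_sqint (test_pderiv [:: i] tq).
  apply: etrans (ae_eq_ip (L2_sqint u).1 sp.1 sdq.1 up) _.
  apply: etrans (ip_pderiv (s := [:: i]) isT tp tq) _.
  apply: (congr1 ( *%R _)); apply: esym.
  exact: (ae_eq_ip (L2_sqint (G i)).1 (sdp i).1 sq.1 (GP i)).
have := friedrichs_const_bound su uG.
rewrite -(ler_pXn2r (ltn0Sn 1)) ?nnegrE ?L2norm_ge0 ?mulr_ge0 ?friedrichs_const_ge0 ?sqrtr_ge0//.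
rewrite exprMn L2norm_sqr; last exact: L2_sqint.
rewrite sqr_sqrtr; last by apply: sumr_ge0 => i _; exact: sqr_ge0.
rewrite (ae_eq_ip2 (L2_sqint u).1 sp.1 (L2_sqint u).1 sp.1 up up) => /le_trans; apply.
rewrite le_eqVlt; apply/orP; left; apply/eqP; apply: (congr1 ( *%R _)).
apply: eq_bigr => i _; rewrite L2norm_sqr; last exact: L2_sqint.
exact: (ae_eq_ip2 (L2_sqint _).1 (sdp i).1 (L2_sqint _).1 (sdp i).1 (GP i) (GP i)).
Qed.

(** With g = |grad phi|^2 = - <phi, Lap phi>, Cauchy-Schwarz gives g^2 <= |phi|^2 |Lap phi|^2 and
    Friedrichs gives |phi|^2 <= c^2 g; one factor g cancels. *)
Lemma gradient_le_laplacian phi : test phi ->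
  \sum_(i < N) ip mu (pderiv [:: i] phi) (pderiv [:: i] phi) <=
  c ^+ 2 * ip mu (laplacian phi) (laplacian phi).
Proof.
move=> tp; have sp := test_sqint tp; have sl := test_sqint (test_laplacian tp).
have := friedrichs_test tp; rewrite (ip_gradient tp).
have G0 : 0 <= - ip mu phi (laplacian phi).
  by rewrite -(ip_gradient tp); apply: sumr_ge0 => i _; exact: ip_ge0.
have := cauchy_schwarz sp sl; have := ip_ge0 mu (laplacian phi).
have := ip_ge0 mu phi; move: G0; rewrite -[ip mu phi _ ^+ 2]sqrrN.
move: (- ip mu phi (laplacian phi)) (ip mu phi phi)
  (ip mu (laplacian phi) (laplacian phi)) => g a l g0 a0 l0 gal acg.
have [->|gn0] := eqVneq g 0; first by rewrite mulr_ge0 ?sqr_ge0.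
have {}g0 : 0 < g by rewrite lt_neqAle eq_sym gn0.
rewrite -(ler_pM2r g0) -expr2; apply: (le_trans gal).
by rewrite mulrAC ler_wpM2r.
Qed.

Lemma le_laplacian phi : test phi ->
  ip mu phi phi <= c ^+ 4 * ip mu (laplacian phi) (laplacian phi).
Proof.
move=> tp; apply: (le_trans (friedrichs_test tp)).
rewrite (_ : c ^+ 4 = c ^+ 2 * c ^+ 2); last by rewrite -exprD.
rewrite -mulrA ler_wpM2l ?sqr_ge0//; exact: gradient_le_laplacian.
Qed.

(** The summands c^4, c^2 and 1 serve the orders 0, 1 and 2. At order 2 a single entry is bounded by
    the whole Hessian sum, which equals |Lap phi|^2. *)
Lemma pderiv_le_laplacian s phi : (size s <= 2)%N -> test phi ->
  ip mu (pderiv s phi) (pderiv s phi) <=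
  (c ^+ 4 + c ^+ 2 + 1) * ip mu (laplacian phi) (laplacian phi).
Proof.
move=> s2 tp; have l0 := ip_ge0 mu (laplacian phi).
have c2 := sqr_ge0 c; have c4 : 0 <= c ^+ 4 by rewrite exprn_even_ge0.
rewrite !mulrDl mul1r.
have h4 := mulr_ge0 c4 l0; have h2 := mulr_ge0 c2 l0.
case: s s2 => [|i [|j []]]// _.
- by apply: (le_trans (le_laplacian tp)); rewrite -addrA lerDl addr_ge0.
- apply: (@le_trans _ _ (c ^+ 2 * ip mu (laplacian phi) (laplacian phi))).
    apply: le_trans (gradient_le_laplacian tp).
    rewrite [leRHS](bigD1 i)//= lerDl; apply: sumr_ge0 => j _; exact: ip_ge0.
  by rewrite -addrA addrCA lerDl addr_ge0.
- apply: (@le_trans _ _ (ip mu (laplacian phi) (laplacian phi))); last by rewrite lerDr addr_ge0.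
  rewrite (ip_laplacian_hessian tp).
  rewrite [leRHS](bigD1 i)//= [X in _ <= X + _](bigD1 j)//= -addrA lerDl addr_ge0//.
    by apply: sumr_ge0 => k _; exact: ip_ge0.
  by apply: sumr_ge0 => k _; apply: sumr_ge0 => l _; exact: ip_ge0.
Qed.

(* Sequential form of [sobolev0 2 u]: convergence of the Laplacians already
   controls all derivatives of order at most 2, by [pderiv_le_laplacian]. *)
Definition H02 u (g : L2 Om) := exists phi : nat -> 'rV[R]_N -> R,
  [/\ forall n, test (phi n), cvg2 mu phi u &
      cvg2 mu (fun n => laplacian (phi n)) g].

Lemma sobolev0_H02 u : sobolev0 2 u -> exists g : L2 Om, H02 u g.
Proof.
move=> /sobolev0_seq[D [phi [uD tp cp]]].
have sD s := L2_sqint (D s).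
have [g gD] := sqint_L2 (sqint_sum (index_enum 'I_N) (fun i => sD [:: i; i])).
have sp s n := test_sqint (test_pderiv s (tp n)).
exists g, phi; split => //.
  (* The entry of the jet at the empty sequence is u itself, as testing shows. *)
  rewrite (_ : u = D [::]); first exact: (cp [::]).
  apply: L2_ext_test => psi tq.
  by have /= := uD [::] isT psi tq; rewrite expr0 mul1r.
apply: (cvg2_ae _ (sqint_sum _ (fun i => sD [:: i; i])) (L2_sqint g) (ae_eq_sym gD)).
  by move=> n; exact: test_sqint (test_laplacian (tp n)).
apply: (@cvg2_sum _ _ _ mu 'I_N _ (fun n i => pderiv [:: i; i] (phi n))
  (fun i => D [:: i; i])) => [n i|i|i].
- exact: (sp [:: i; i]).
- exact: (sD [:: i; i]).
- exact: (cp [:: i; i]).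
Qed.

Lemma H02_weak_laplacian u (g : L2 Om) : H02 u g -> weak_laplacian Om u g.
Proof.
move=> [phi [tp pu pg]] psi tq.
have sp n := test_sqint (tp n); have sl n := test_sqint (test_laplacian (tp n)).
have sq := test_sqint tq; have slq := test_sqint (test_laplacian tq).
have c1 := cvg2_ip sp (L2_sqint u) (fun=> slq) slq pu (cvg2_cst mu _).
have c2 := cvg2_ip sl (L2_sqint g) (fun=> sq) sq pg (cvg2_cst mu _).
rewrite (_ : (fun n => ip mu (phi n) (laplacian psi)) =
    fun n => ip mu (laplacian (phi n)) psi) in c1; last first.
  by apply/funext => n; exact: ip_laplacian.
by apply: (cvg_unique _ c1 c2); exact: Rhausdorff.
Qed.

Lemma weak_laplacian_unique u (g h : L2 Om) :
  weak_laplacian Om u g -> weak_laplacian Om u h -> g = h.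
Proof.
by move=> ug uh; apply: L2_ext_test => psi tq; apply: etrans (esym (ug _ tq)) (uh _ tq).
Qed.

Lemma H02_estimate u (g : L2 Om) : H02 u g -> ip mu u u <= c ^+ 4 * ip mu g g.
Proof.
move=> [phi [tp pu pg]].
have sp n := test_sqint (tp n); have sl n := test_sqint (test_laplacian (tp n)).
have c1 := cvg2_ip sp (L2_sqint u) sp (L2_sqint u) pu pu.
have c2 := cvgMl_tmp (a := c ^+ 4) (cvg2_ip sl (L2_sqint g) sl (L2_sqint g) pg pg).
apply: (ler_cvg_to c1 (c2 _)); apply: nearW => n; exact: le_laplacian.
Qed.

(** Extends a weak identity from test functions to their closure. Symmetry, positivity, the second
    estimate and the variational equation all come from it. *)
Lemma H02_test_eq u (g : L2 Om) f h : H02 u g -> sqint mu f -> sqint mu h ->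
  (forall psi, test psi -> ip mu f (laplacian psi) = ip mu h psi) ->
  ip mu f g = ip mu h u.
Proof.
move=> [phi [tp pu pg]] sf sh fh.
have sp n := test_sqint (tp n); have sl n := test_sqint (test_laplacian (tp n)).
have c1 := cvg2_ip (fun=> sh) sh sp (L2_sqint u) (cvg2_cst mu _) pu.
have c2 := cvg2_ip (fun=> sf) sf sl (L2_sqint g) (cvg2_cst mu _) pg.
rewrite (_ : (fun n => ip mu f (laplacian (phi n))) = fun n => ip mu h (phi n)) in c2; last first.
  by apply/funext => n; exact: fh.
by apply: (cvg_unique _ c2 c1); exact: Rhausdorff.
Qed.

(** Completeness of the closure of the test functions under |Lap u|: a Cauchy bound on Laplacians is
    one on every derivative of order at most two, at the cost of the factor K. *)
Lemma laplacian_cauchy_lim (phi : nat -> 'rV[R]_N -> R) (C : R) :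
  (forall n, test (phi n)) ->
  (forall n m, (n <= m)%N ->
    ip mu (laplacian (fun x => 1 * phi n x + -1 * phi m x))
          (laplacian (fun x => 1 * phi n x + -1 * phi m x)) <= C / 8 ^+ n) ->
  exists u g : L2 Om, [/\ sobolev0 2 u, cvg2 mu phi u &
    cvg2 mu (fun n => laplacian (phi n)) g].
Proof.
move=> tp cp; pose K := c ^+ 4 + c ^+ 2 + 1.
have K0 : 0 <= K by rewrite !addr_ge0 ?sqr_ge0 ?exprn_even_ge0.
have sp s n := test_sqint (test_pderiv s (tp n)).
have /choice[D DP] : forall s, exists v : L2 Om,
    (size s <= 2)%N -> cvg2 mu (fun n => pderiv s (phi n)) v.
  move=> s; have [s2|s2] := leqP (size s) 2; last first.
    (* Beyond length two the jet is unconstrained; the class of zero is a default. *)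
    by have [v _] := sqint_L2 (sqint0 mu); exists v.
  have [f sf cf] : exists2 f, sqint mu f & cvg2 mu (fun n => pderiv s (phi n)) f.
    apply: (@rapid_cauchy_cvg _ _ _ mu _ (K * C)) => // n m nm.
    have td := test_lin 1 (-1) (tp n) (tp m).
    have := pderiv_le_laplacian s2 td; rewrite pderiv_lin; [|by case: (tp n)|by case: (tp m)].
    rewrite (_ : (fun x => 1 * _ + _) = (fun x => pderiv s (phi n) x - pderiv s (phi m) x)); last first.
      by apply/funext => x; rewrite mul1r mulN1r.
    by move=> /le_trans; apply; rewrite -mulrA ler_wpM2l//; exact: cp.
  have [v vf] := sqint_L2 sf; exists v => _.
  exact: (cvg2_ae (sp s) sf (L2_sqint v) (ae_eq_sym vf) cf).
have sD s := L2_sqint (D s).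
have su : sobolev0 2 (D [::]) by exact: sobolev0_lim tp DP.
have [g gD] := sqint_L2 (sqint_sum (index_enum 'I_N) (fun i => sD [:: i; i])).
exists (D [::]), g; split => //; first exact: (DP [::]).
apply: (cvg2_ae _ (sqint_sum _ (fun i => sD [:: i; i])) (L2_sqint g) (ae_eq_sym gD)).
  by move=> n; exact: test_sqint (test_laplacian (tp n)).
apply: (@cvg2_sum _ _ _ mu 'I_N _ (fun n i => pderiv [:: i; i] (phi n))
  (fun i => D [:: i; i])) => [n i|i|i].
- exact: (sp [:: i; i]).
- exact: (sD [:: i; i]).
- exact: (DP [:: i; i]).
Qed.

Lemma biLaplacianDP u (f : L2 Om) :
  biLaplacianD u f <-> sobolev0 2 u /\ weak_bilaplacian Om u f.
Proof.
split.
  move=> [g [su ug] gf]; split; [exact: su|move=> phi tp].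
  have tl := test_laplacian tp.
  apply: etrans (ug _ tl) _; apply: etrans (ipNl (L2_sqint g) (test_sqint tl)) _.
  have := gf _ tp; rewrite -[inner _ _ _]/(ip mu g (laplacian phi)) => ->.
  by rewrite -[inner _ _ _]/(ip mu (fun x => - f x) phi) ipNl ?opprK//; [exact: L2_sqint|exact: test_sqint].
move=> [su uf]; have [g ug] := sobolev0_H02 su.
(* The intermediate value in the composition is - Lap u, hence the class of - g; the two signs
   cancel in Lap^2. *)
have [h hg] := sqint_L2 (sqintN (L2_sqint g)).
have wg := H02_weak_laplacian ug.
exists h; last first.
  move=> phi tp; have tl := test_laplacian tp.
  apply: etrans (ae_eq_ip (L2_sqint h).1 (sqintN (L2_sqint g)).1 (test_sqint tl).1 hg) _.
  rewrite ipNl; [|exact: L2_sqint|exact: test_sqint].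
  apply: etrans (congr1 -%R (etrans (esym (wg _ tl)) (uf _ tp))) _.
  by apply: esym; apply: ipNl; [exact: L2_sqint|exact: test_sqint].
split; [exact: su|move=> phi tp; apply: etrans (wg _ tp) _].
have sp := test_sqint tp; have sh := L2_sqint h; have sg := L2_sqint g.
apply: (ae_eq_ip sg.1 (sqintN sh).1 sp.1).
by apply: filterS hg => x /[apply] /= ->; rewrite opprK.
Qed.

Lemma biLaplacianD_H02 u (f : L2 Om) : biLaplacianD u f ->
  exists2 g : L2 Om, H02 u g &
    forall psi, test psi -> ip mu g (laplacian psi) = ip mu f psi.
Proof.
move=> /biLaplacianDP[su uf]; have [g ug] := sobolev0_H02 su.
exists g; [exact: ug|move=> psi tq].
apply: etrans (esym (H02_weak_laplacian ug (test_laplacian tq))) _.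
exact: uf.
Qed.

Lemma biLaplacianD_surj (f : L2 Om) : exists u, biLaplacianD u f.
Proof.
have sf := L2_sqint f.
have sl phi (tp : test phi) := test_sqint (test_laplacian tp).
(* The constant comes from <f, phi>^2 <= |f|^2 |phi|^2 <= |f|^2 c^4 |Lap phi|^2. The first variation
   of the minimising sequence is the weak equation Lap^2 u = f. *)
have [||||||||phi tp [[C cp] lp]] := @minimising_sequence _ R test
  (fun p q => ip mu (laplacian (p : 'rV[R]_N -> R)) (laplacian q)) (ip mu f) (ip mu f f * c ^+ 4).
- by exists (fun=> 0); exact: test0.
- by move=> s t u v; exact: test_lin.
- move=> s t u v w tu tv tw; rewrite (laplacian_lin _ _ tu tv).
  by apply: ip_linl; exact: sl.
- by move=> u v _ _; exact: ipC.
- by move=> u _; exact: ip_ge0.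
- move=> s t u v tu tv; have su := test_sqint tu; have sv := test_sqint tv.
  by rewrite ipC ip_linl// ![ip mu f _]ipC.
- by rewrite mulr_ge0 ?ip_ge0 ?exprn_even_ge0.
- move=> u tu; apply: le_trans (cauchy_schwarz sf (test_sqint tu)) _.
  by rewrite -mulrA ler_wpM2l ?ip_ge0//; exact: le_laplacian.
have [u [g [su pu pg]]] := laplacian_cauchy_lim tp cp.
exists u; apply/biLaplacianDP; split; [exact: su|move=> psi tq].
have ug : H02 u g by exists phi.
have tl := test_laplacian tq.
apply: etrans (H02_weak_laplacian ug tl) _.
have c1 := cvg2_ip (fun n => sl _ (tp n)) (L2_sqint g) (fun=> sl _ tq) (sl _ tq) pg (cvg2_cst mu _).
by apply: (cvg_unique _ c1 (lp _ tq)); exact: Rhausdorff.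
Qed.

(** Places every test function in the domain of the operator, so that density reduces to density of
    the test functions in L^2. *)
Lemma biLaplacianD_test phi u (f : L2 Om) : test phi -> ae_eq mu setT u phi ->
  ae_eq mu setT f (laplacian (laplacian phi)) -> biLaplacianD u f.
Proof.
move=> tp up ff; apply/biLaplacianDP; split; first exact: sobolev0_test up.
have tl := test_laplacian tp; have tll := test_laplacian tl.
move=> psi tq; have tm := test_laplacian tq; have tmm := test_laplacian tm.
apply: etrans (ae_eq_ip (L2_sqint u).1 (test_sqint tp).1 (test_sqint tmm).1 up) _.
transitivity (ip mu (laplacian phi) (laplacian psi)); first exact: (ip_laplacian tp tm).
transitivity (ip mu (laplacian (laplacian phi)) psi); first exact: (ip_laplacian tl tq).
by apply: esym; exact: (ae_eq_ip (L2_sqint f).1 (test_sqint tll).1 (test_sqint tq).1 ff).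
Qed.

Lemma biLaplacianD_dense : op_dense (@biLaplacianD R N Om).
Proof.
move=> v e e0; have sv := L2_sqint v.
(* Here the functional is |phi - v|^2 - |v|^2, so a minimising sequence is one of best
   approximations of v by test functions. *)
have [||||||||phi tp [[C cp] lp]] := @minimising_sequence _ R test
  (ip mu) (ip mu v) (ip mu v v).
- by exists (fun=> 0); exact: test0.
- by move=> s t u w; exact: test_lin.
- by move=> s t u w z tu tw tz; apply: ip_linl; exact: test_sqint.
- by move=> u w _ _; exact: ipC.
- by move=> u _; exact: ip_ge0.
- move=> s t u w tu tw; have su := test_sqint tu; have sw := test_sqint tw.
  by rewrite ipC ip_linl// ![ip mu v _]ipC.
- exact: ip_ge0.
- by move=> u tu; exact: cauchy_schwarz sv (test_sqint tu).
have sp n := test_sqint (tp n).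
have [p sfp pp] : exists2 p, sqint mu p & cvg2 mu phi p.
  apply: (@rapid_cauchy_cvg _ _ _ mu phi C) => // n m /cp.
  rewrite (_ : (fun x => 1 * _ + _) = (fun x => phi n x - phi m x))//.
  by apply/funext => x; rewrite mul1r mulN1r.
(* The limit has the same products with test functions as v, so no distance to v is left. *)
have pv : ae_eq mu setT p v.
  apply: ae_eq_of_test => // psi tq; have sq := test_sqint tq.
  have c1 := cvg2_ip sp sfp (fun=> sq) sq pp (cvg2_cst mu _).
  by apply: (cvg_unique _ c1 (lp _ tq)); exact: Rhausdorff.
have /cvgr0Pnorm_lt/(_ _ (exprn_gt0 2 e0))[n _ /(_ n (leqnn n)) /= Hn] := cvg2_ae sp sfp sv pv pp.
have [u up] := sqint_L2 (sp n).
have [f ff] := sqint_L2 (test_sqint (test_laplacian (test_laplacian (tp n)))).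
exists u; first by exists f; exact: biLaplacianD_test (tp n) up ff.
rewrite -(ltr_pXn2r (ltn0Sn 1)) ?nnegrE ?L2norm_ge0 ?ltW//.
rewrite L2norm_sqr; last by apply: sqintB => //; exact: L2_sqint.
apply: le_lt_trans Hn; apply: le_trans (ler_norm _).
rewrite le_eqVlt; apply/orP; left; apply/eqP.
apply: etrans _ (ip_subC _ _ _).
have s1 := sqintB sv (L2_sqint u); have s2 := sqintB sv (sp n).
have ae : ae_eq mu setT (fun x => v x - u x) (fun x => v x - phi n x).
  by apply: filterS up => x /[apply] /= ->.
exact: (ae_eq_ip2 s1.1 s2.1 s1.1 s2.1 ae ae).
Qed.

(** Both sides equal the inner product of the Laplacians of u and v. *)
Lemma biLaplacianD_sym u v (f h : L2 Om) : biLaplacianD u f -> biLaplacianD v h ->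
  ip mu f v = ip mu u h.
Proof.
move=> /biLaplacianD_H02[g ug gf] /biLaplacianD_H02[k vk kh].
have e1 := H02_test_eq vk (L2_sqint g) (L2_sqint f) gf.
have e2 := H02_test_eq ug (L2_sqint k) (L2_sqint h) kh.
by rewrite -e1 ipC e2 ipC.
Qed.

Lemma L2_ip_ext u v : (forall w : L2 Om, ip mu w u = ip mu w v) -> u = v.
Proof.
move=> uv; apply: L2_ext_test => psi tq.
have sq := test_sqint tq; have [w wp] := sqint_L2 sq.
rewrite ipC [RHS]ipC.
rewrite -(ae_eq_ip (L2_sqint w).1 sq.1 (L2_sqint u).1 wp).
by rewrite -(ae_eq_ip (L2_sqint w).1 sq.1 (L2_sqint v).1 wp).
Qed.

(** Symmetry and surjectivity suffice: every h is the image of some w, and <h, u> = <w, f> = <h,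
    v>. *)
Lemma biLaplacianD_inj u v (f : L2 Om) : biLaplacianD u f -> biLaplacianD v f -> u = v.
Proof.
move=> uf vf; apply: L2_ip_ext => h; have [w wh] := biLaplacianD_surj h.
by rewrite (biLaplacianD_sym wh uf) (biLaplacianD_sym wh vf).
Qed.

(** The second bound bootstraps the first: |g|^2 = <f, u> <= |f| |u| <= c^2 |f| |g|, and one factor
    |g| cancels. *)
Lemma biLaplacianD_estimate u (f g : L2 Om) : H02 u g ->
  (forall psi, test psi -> ip mu g (laplacian psi) = ip mu f psi) ->
  L2norm Om u <= c ^+ 2 * L2norm Om g /\ L2norm Om g <= c ^+ 2 * L2norm Om f.
Proof.
move=> ug gf; have su := L2_sqint u; have sf := L2_sqint f; have sg := L2_sqint g.
have c0 := friedrichs_const_ge0; have c2 : 0 <= c ^+ 2 by exact: sqr_ge0.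
have e1 : L2norm Om u <= c ^+ 2 * L2norm Om g.
  rewrite -(ler_pXn2r (ltn0Sn 1)) ?nnegrE ?mulr_ge0 ?L2norm_ge0//.
  by rewrite exprMn !L2norm_sqr// -exprM; exact: H02_estimate.
split => //.
have e2 : L2norm Om g ^+ 2 <= L2norm Om f * L2norm Om u.
  rewrite L2norm_sqr// (H02_test_eq ug sg sf gf).
  by rewrite !L2normE//; apply: le_trans (ler_norm _) _; exact: norm_ip_le.
have g0 := L2norm_ge0 Om g; have f0 := L2norm_ge0 Om f.
have [->|gn0] := eqVneq (L2norm Om g) 0; first by rewrite mulr_ge0.
have {}g0 : 0 < L2norm Om g by rewrite lt_neqAle eq_sym gn0.
rewrite -(ler_pM2r g0) -expr2; apply: (le_trans e2).
by rewrite mulrAC mulrC ler_wpM2r.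
Qed.

End friedrichs.

Theorem mainTheorem2 (R : realType) (N : nat) (Om : domain R N)
    (hOm : friedrichs_admissible Om) :
  let c := friedrichs_const Om in
  let B := @biLaplacianD R N Om in
  [/\ (forall u f : L2 Om,
        B u f <-> sobolev0 2 u /\ weak_bilaplacian Om u f),
      [/\ op_functional B, op_selfadjoint B, op_positive B & op_bijective B],
      (op_norm (op_inv B) <= (c ^+ 4)%:E)%E,
      (forall u f : L2 Om, B u f ->
        exists2 g : L2 Om, weak_laplacian Om u g &
          L2norm Om u <= c ^+ 2 * L2norm Om g /\
          c ^+ 2 * L2norm Om g <= c ^+ 4 * L2norm Om f) &
      (forall f : L2 Om, exists2 u : L2 Om, op_inv B f u &
        unique (fun v : L2 Om => sobolev0 2 v /\ weak_bilaplacian Om v f) u /\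
        unique (fun v : L2 Om => sobolev0 2 v /\ variational_solution f v) u)].
Proof.
move=> c B.
have c0 : 0 <= c by exact: friedrichs_const_ge0.
have c2 : 0 <= c ^+ 2 by exact: sqr_ge0.
have c4 : c ^+ 4 = c ^+ 2 * c ^+ 2 by rewrite -exprD.
have est (u f : L2 Om) : B u f -> exists2 g : L2 Om, weak_laplacian Om u g &
    L2norm Om u <= c ^+ 2 * L2norm Om g /\
    c ^+ 2 * L2norm Om g <= c ^+ 4 * L2norm Om f.
  move=> /biLaplacianD_H02[g ug gf]; exists g; first exact: H02_weak_laplacian.
  have [e1 e2] := biLaplacianD_estimate hOm ug gf; split; first exact: e1.
  by rewrite c4 -mulrA; exact: ler_wpM2l.
have inj u v f : B u f -> B v f -> u = v by exact: biLaplacianD_inj.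
have surj f : exists u, B u f by exact: biLaplacianD_surj.
split.
- exact: biLaplacianDP.
- split.
  + move=> u f g /biLaplacianDP[_ uf] /biLaplacianDP[_ ug].
    by apply: L2_ext_test => psi tq; exact: etrans (esym (uf _ tq)) (ug _ tq).
  + split; first exact: biLaplacianD_dense.
    move=> u f; split => [uf v h vh|uf].
      by apply: etrans (biLaplacianD_sym vh uf) _.
    (* Let u be in the domain of the adjoint with image f, and let w solve B w = f. For every h = B
       v, <h, u> = <v, f> = <h, w>, so u = w lies in the domain of B. *)
    have [w wf] := surj f; rewrite (_ : u = w)//.
    apply: L2_ip_ext => h; have [v vh] := surj h.
    by apply: etrans (uf _ _ vh) _; exact: (esym (biLaplacianD_sym vh wf)).
  + move=> u f uf un0.
    have [g ug gf] := biLaplacianD_H02 uf.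
    rewrite -[inner _ _ _]/(ip (mu_dom Om) f u).
    (* <B u, u> is |Lap u|^2, and if this vanishes the estimate by the Laplacian forces u = 0. *)
    rewrite -(H02_test_eq ug (L2_sqint g) (L2_sqint f) gf).
    rewrite lt_neqAle ip_ge0 andbT; apply/eqP => g0; apply: un0.
    apply: ip_eq0; first exact: L2_sqint.
    apply/eqP; rewrite eq_le ip_ge0 andbT.
    by apply: le_trans (H02_estimate hOm ug) _; rewrite -g0 mulr0.
  + by split; [exact: inj|exact: surj].
- apply: ge_ereal_sup => _ [p [/est[g _ [e1 e2]] p1] <-].
  rewrite lee_fin; apply: le_trans e1 _; apply: le_trans e2 _.
  by rewrite ler_piMr// exprn_even_ge0.
- exact: est.
- move=> f; have [u uf] := surj f; exists u => //; split; split.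
  + by apply/biLaplacianDP.
  + by move=> v /biLaplacianDP; exact: inj.
  + split; first by have /biLaplacianDP[] := uf.
    have [g ug gf] := biLaplacianD_H02 uf.
    exists g; first exact: H02_weak_laplacian.
    move=> phi h /sobolev0_H02[k pk] ph.
    (* Uniqueness of weak Laplacians identifies h with the limit k of Laplacians of test functions,
       for which the approximation argument is available. *)
    rewrite (weak_laplacian_unique ph (H02_weak_laplacian pk)).
    exact: (H02_test_eq pk (L2_sqint g) (L2_sqint f) gf).
  + move=> v [sv [g vg gf]]; apply: (inj _ _ f uf); apply/biLaplacianDP; split => //.
    move=> psi tq; apply: etrans (vg _ (test_laplacian tq)) _.
    (* The classes of psi and of its Laplacian are admissible in the variational equation, which
       then reads as the weak equation Lap^2 v = f tested against psi. *)
    have [p pp] := sqint_L2 (test_sqint tq).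
    have [h hh] := sqint_L2 (test_sqint (test_laplacian tq)).
    have sp : sobolev0 2 p by exact: sobolev0_test pp.
    have sq := test_sqint tq; have sl := test_sqint (test_laplacian tq).
    have ph : weak_laplacian Om p h.
      move=> phi tp; have tl := test_laplacian tp; have slp := test_sqint tl.
      apply: etrans (ae_eq_ip (L2_sqint p).1 sq.1 slp.1 pp) _.
      transitivity (ip (mu_dom Om) (laplacian psi) phi); first exact: (ip_laplacian tq tp).
      by apply: esym; exact: (ae_eq_ip (L2_sqint h).1 sl.1 (test_sqint tp).1 hh).
    have := gf p h sp ph.
    rewrite -[inner _ _ _]/(ip (mu_dom Om) g h) -[inner _ f _]/(ip (mu_dom Om) f p).
    rewrite ipC (ae_eq_ip (L2_sqint h).1 sl.1 (L2_sqint g).1 hh) ipC.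
    move=> gp; apply: (etrans gp); apply: etrans (ipC _ _ _) (etrans _ (ipC _ _ _)).
    exact: (ae_eq_ip (L2_sqint p).1 sq.1 (L2_sqint f).1 pp).
Qed.
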